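(* Every highly homogeneous (oligomorphic) automorphism group $G\le S(\mathbb{N})$ has a minimum Hausdorff group topology. That minimum group topology is strictly coarser than the topology of pointwise convergence $\tau_p$ on $G$, except when $G=S(\mathbb{N})$; and so, when $G\neq S(\mathbb{N})$, $\tau_p$ is not a minimal Hausdorff group topology on $G$.
   Context: $S(\mathbb{N})$ is the group of all permutations of the countably infinite set $\mathbb{N}$. The topology of pointwise convergence $\tau_p$ on $S(\mathbb{N})$ (and, by restriction, on its subgroups) has as basic neighborhoods of the identity the pointwise stabilizers of finite subsets of $\mathbb{N}$. An automorphism group is the automorphism group of a countable model of a first order theory with underlying set $\mathbb{N}$; equivalently, a $\tau_p$-closed subgroup of $S(\mathbb{N})$. It is oligomorphic if for each $n\ge1$ its natural action on $\mathbb{N}^n$ has finitely many orbits. A subgroup $G$ of $S(\mathbb{N})$ is highly homogeneous if for any two finite subsets $A,B$ of $\mathbb{N}$ of the same size there is $g\in G$ with $g(A)=B$. A topology on a group is a group topology if the group operations are continuous for it. A minimum Hausdorff group topology on $G$ is a Hausdorff group topology on $G$ contained in every Hausdorff group topology on $G$. A Hausdorff group topology on $G$ is minimal if no strictly coarser group topology on $G$ is Hausdorff. *)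

(* Defs.v *)
From HB Require Import structures.
From mathcomp Require Import all_boot.
From mathcomp Require Import finmap.
From mathcomp Require Import all_classical all_reals all_analysis.

Set Implicit Arguments.
Unset Strict Implicit.
Unset Printing Implicit Defensive.

Local Open Scope classical_set_scope.
Local Open Scope group_scope.

Definition SN : Type := {f : nat -> nat | `[< bijective f >]}.

HB.instance Definition _ := Choice.on SN.
HB.instance Definition _ := SubType.on SN.

Definition SN_fun (g : SN) : nat -> nat := \val g.
Coercion SN_fun : SN >-> Funclass.

Lemma SN_bij (g : SN) : bijective g.
Proof. exact: asboolW (valP g). Qed.

Definition SN_of (f : nat -> nat) (bf : bijective f) : SN := exist _ f (asboolT bf).

Lemma SN_inv_ex (g : SN) : exists h : SN, cancel g h /\ cancel h g.
Proof.
have [h gK hK] := SN_bij g.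
by exists (SN_of (Bijective hK gK)).
Qed.

Lemma SN_ext (g h : SN) : g =1 h -> g = h.
Proof. by move=> gh; apply/val_inj/funext. Qed.

Definition SN1 : SN := SN_of (Bijective (frefl id) (frefl id)).
Definition SN_mul (g h : SN) : SN := SN_of (bij_comp (SN_bij g) (SN_bij h)).
Definition SN_inv (g : SN) : SN := sval (cid (SN_inv_ex g)).

Lemma SN_mulA : associative SN_mul. Proof. by move=> f g h; exact: SN_ext. Qed.
Lemma SN_1mul : left_id SN1 SN_mul. Proof. by move=> f; exact: SN_ext. Qed.
Lemma SN_mul1 : right_id SN1 SN_mul. Proof. by move=> f; exact: SN_ext. Qed.
Lemma SN_Vmul : left_inverse SN1 SN_inv SN_mul.
Proof. by move=> g; apply: SN_ext; exact: (svalP (cid (SN_inv_ex g))).1. Qed.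
Lemma SN_mulV : right_inverse SN1 SN_inv SN_mul.
Proof. by move=> g; apply: SN_ext; exact: (svalP (cid (SN_inv_ex g))).2. Qed.

(* Multiplication is composition: (g * h) n = g (h n). *)
HB.instance Definition _ :=
  isGroup.Build SN SN_mulA SN_1mul SN_mul1 SN_Vmul SN_mulV.

(* Constants are the function symbols of arity 0. *)
Record signature := Signature {
  rel_symb : Type;
  rel_arity : rel_symb -> nat;
  fun_symb : Type;
  fun_arity : fun_symb -> nat }.

Record structure (L : signature) (T : Type) := Structure {
  rel_interp : forall r : rel_symb L, set ((rel_arity r).-tuple T);
  fun_interp : forall f : fun_symb L, (fun_arity f).-tuple T -> T }.

Definition automorphism (L : signature) (M : structure L nat) (g : SN) : Prop :=
  (forall (r : rel_symb L) (t : (rel_arity r).-tuple nat),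
     rel_interp M t <-> rel_interp M (map_tuple g t)) /\
  (forall (f : fun_symb L) (t : (fun_arity f).-tuple nat),
     g (fun_interp M t) = fun_interp M (map_tuple g t)).

(* A structure is always a model of a first order theory (its own one), so no
   theory needs to be mentioned. *)
Definition automorphism_group (H : set SN) : Prop :=
  exists (L : signature) (M : structure L nat), H = automorphism M.

Definition oligomorphic (H : set SN) : Prop :=
  forall n : nat, (1 <= n)%N ->
    finite_set [set [set map_tuple (g : SN) t | g in H] | t in [set: n.-tuple nat]].

Definition highly_homogeneous (H : set SN) : Prop :=
  forall A B : set nat, finite_set A -> finite_set B -> (A #= B)%card ->
    exists2 g : SN, H g & g @` A = B.

(* Topologies on a fixed type T are the inhabitants of the class [Topological T];
   they are compared through their sets of open sets. *)
Definition opens (T : Type) (tau : Topological T) : set (set T) :=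
  @open (Topological.Pack tau).

Definition coarser (T : Type) (sigma tau : Topological T) : Prop :=
  opens sigma `<=` opens tau.

Definition strictly_coarser (T : Type) (sigma tau : Topological T) : Prop :=
  opens sigma `<` opens tau.

Definition group_topology (G : groupType) (tau : Topological G) : Prop :=
  let X : topologicalType := Topological.Pack tau in
  continuous (fun p : X * X => (p.1 : G) * (p.2 : G) : X) /\
  continuous (fun x : X => (x : G)^-1 : X).

Definition hausdorff_group_topology (G : groupType) (tau : Topological G) : Prop :=
  group_topology tau /\ hausdorff_space (Topological.Pack tau).

Definition minimum_hausdorff_group_topology (G : groupType)
    (tau : Topological G) : Prop :=
  hausdorff_group_topology tau /\
  forall sigma : Topological G, hausdorff_group_topology sigma -> coarser tau sigma.

Definition minimal_hausdorff_group_topology (G : groupType)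
    (tau : Topological G) : Prop :=
  hausdorff_group_topology tau /\
  forall sigma : Topological G, group_topology sigma ->
    strictly_coarser sigma tau -> ~ hausdorff_space (Topological.Pack sigma).

(* A subgroup of S(N) is given by its membership predicate H, and G is the group
   that it forms, with \val : G -> SN the inclusion. The carrier of G is only
   determined up to isomorphism over SN. *)
Definition pointwise_topology (H : pred SN) (G : subGroupType H) : Topological G :=
  Topological.class
    (initial_topology (fun g : G => (\val g : SN) : {ptws nat -> nat})).
Arguments pointwise_topology {H} G.

Lemma nbhs_ptws_nat (f : {ptws nat -> nat}) (U : set {ptws nat -> nat}) :
  nbhs f U <-> exists F : seq nat, [set g : {ptws nat -> nat} | {in F, (g : nat -> nat) =1 f}] `<=` U.
Proof.
split.
  move=> [] P [] [] Q QfinP <- [] V JV Vf sU.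
  have {sU} VU : V `<=` U by move=> g Vg; apply: sU; exists V.
  have [L Lsub VL] := QfinP _ JV.
  suff [F FV] : exists F : seq nat, [set g : {ptws nat -> nat} | {in F, (g : nat -> nat) =1 f}] `<=` V.
    by exists F; exact: subset_trans VU.
  have h : forall M, M \in L -> exists n, [set g : nat -> nat | g n = f n] `<=` M.
    move=> M LM; have := Lsub _ LM; rewrite inE => Z; case: Z => i Z1 Z2; case: Z2 => W oW WM.
    exists i => g /= gi; have : M f by rewrite -VL in Vf; exact: (Vf M LM).
    by rewrite -WM /= gi.
  have /choice[k kP] : forall M : set (nat -> nat), exists n,
      M \in L -> [set g : nat -> nat | g n = f n] `<=` M.
    by move=> M; case: (boolP (M \in L)) => [/h[n hn]|_]; [exists n|exists 0].
  exists [seq k M | M <- L] => g /= gF; rewrite -VL => M LM.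
  by apply: (kP M LM) => /=; apply: gF; apply/mapP; exists M.
move=> [F FU]; apply: (@filterS _ (nbhs f) _ _ _ FU); move: FU => _.
elim: F => [|n F IH].
  by apply: (@filterS _ (nbhs f) _ setT) => [g _ m|]; [|exact: filterT].
have pn : nbhs f [set g : {ptws nat -> nat} | g n = f n].
  apply: (@proj_continuous nat (fun=> nat) n f [set k | k = f n]).
  by apply: open_nbhs_nbhs; split => //; exact: discrete_open.
apply: (@filterS _ (nbhs f) _ _ _ _ (filterI pn IH)) => g [/= gn gF] m.
by rewrite inE => /orP[/eqP->|/gF].
Qed.

Section PointwiseTopology.
Variables (H : pred SN) (G : subGroupType H).
Let X : topologicalType := Topological.Pack (pointwise_topology G).

(* At x = 1 the basic neighborhoods are the pointwise stabilizers of finite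
   subsets of N. *)
Lemma nbhs_pointwise (x : X) (U : set X) : nbhs x U <->
 exists F : seq nat, [set y : X | {in F, (\val (y : G) : SN) =1 (\val (x : G) : SN)}] `<=` U.
Proof.
split.
  move=> [_ [/= [V oV <-] Vx VU]].
  have : nbhs ((\val (x:G) : SN) : {ptws nat -> nat}) V by exact: open_nbhs_nbhs.
  move=> /nbhs_ptws_nat [F FV]; exists F => y /= yF; apply: VU => /=; exact: FV.
move=> [F FU].
have : nbhs ((\val (x:G) : SN) : {ptws nat -> nat}) [set g : {ptws nat -> nat} | {in F, (g : nat -> nat) =1 (\val (x:G) : SN)}].
  by apply/nbhs_ptws_nat; exists F.
move=> /(@initial_continuous G {ptws nat -> nat} (fun g => \val g : SN) x) h.
exact: filterS FU h.
Qed.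

Lemma pointwise_hausdorff_group_topology : hausdorff_group_topology (pointwise_topology G).
Proof.
split; [split|].
- move=> [x y] U /nbhs_pointwise[F FU].
  exists ([set x' : X | {in [seq (\val (y : G) : SN) n | n <- F],  (\val (x' : G) : SN) =1 (\val (x : G) : SN)}],
    [set y' : X | {in F,  (\val (y' : G) : SN) =1 (\val (y : G) : SN)}]) => /=.
    by split; apply/nbhs_pointwise; [exists [seq (\val (y : G) : SN) n | n <- F]|exists F].
  move=> [x' y'] /= [hx hy]; apply: FU => n nF /=.
  rewrite !gmulfM /= /SN_fun/= -!/(SN_fun _).
  by rewrite hy// hx// map_f.
- move=> x U /nbhs_pointwise[F FU]; apply/nbhs_pointwise.
  exists [seq (\val (x^-1 : G) : SN) n | n <- F] => y hy; apply: FU => n nF /=.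
  have e (z : G) m : (\val z : SN) ((\val z^-1 : SN) m) = m.
    have : (\val z * \val z^-1)%g = 1%g :> SN by rewrite -gmulfM mulgV gmulf1.
    by move=> /(congr1 (fun h : SN => h m)).
  apply: (bij_inj (SN_bij (\val (y : G) : SN))); rewrite e.
  rewrite [RHS]hy ?map_f//; symmetry; exact: (e x).
- move=> x y /= cl; apply: (@val_inj _ _ G); apply: SN_ext => n.
  have [] := cl [set z : X | (\val (z : G) : SN) n = (\val (x : G) : SN) n]
    [set z : X | (\val (z : G) : SN) n = (\val (y : G) : SN) n].
  + by apply/nbhs_pointwise; exists [:: n] => z /= ->//; rewrite inE.
  + by apply/nbhs_pointwise; exists [:: n] => z /= ->//; rewrite inE.
  by move=> z [/= <-].
Qed.

End PointwiseTopology.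

(* Main.v *)
Require Import Defs.
From HB Require Import structures.
From mathcomp Require Import all_boot all_order all_algebra.
From mathcomp Require Import all_classical all_reals all_analysis.
From mathcomp Require Import ring lra zify.

(** Let H be the group, a closed subgroup of S(N), with its abstract copy G.

    A nonprincipal ultrafilter on N, iterated n times, concentrates on one of the
    finitely many orbits of H on N^n; a sequence in that orbit is called generic.
    Deleting entries preserves genericity, and high homogeneity gives every finite
    set a generic enumeration. A limit of such enumerations along the ultrafilter is
    a linear order of N whose increasing sequences are all generic; it provides the
    back steps of a back-and-forth construction (ex_generic_numbering) of a bijection
    from the rationals to N that maps all increasing sequences to generic ones. As H
    is closed, it contains the copy of Aut(Q, <) (ex_rational_order), and from then on
    H acts on Q.

    Next comes a dichotomy, a weak form of Cameron's classification of the highly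
    homogeneous groups: either every finite injective sequence of rationals lies in
    the orbit of an increasing one, and then H is all of S(N) since it is closed
    (full_of_all_good), or H preserves the separation relation of the circle obtained
    from Q by joining its ends (sep_homo). Indeed, for g in H, ultrafilters converging
    to cuts of Q from the left provide long blocks of points on which g is monotone
    and whose images do not interlace. If g does not preserve separation, these blocks
    exhibit suffix reversals, suffix rotations or similar rearrangements of arbitrary
    length that keep increasing sequences in their orbit, and those sort any sequence.

    Two lower bounds on a Hausdorff group topology come from the same observation: if
    f and f' do not commute, then the conjugate of f by any g close to 1 does not
    commute with f' either, so g moves some point of the support of f into the support
    of f' (near_meets_support). For H = S(N), transpositions show that the pointwise
    topology is the minimum (pointwise_coarser_full, due to Gaughan). Otherwise, f and
    f' are taken in Aut(Q, <) with supports in a small interval, and preservation of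
    separation shows that every Hausdorff group topology contains the topology of
    pointwise convergence for the order topology of Q. Since arcs of the circle are
    open intervals or complements of closed ones, separation also makes the latter a
    Hausdorff group topology, so it is the minimum (order_topology_minimum). It is
    strictly coarser than the pointwise topology because arbitrarily small bumps move
    0 (order_topology_strictly_coarser), so the pointwise topology is not minimal. *)

Set Implicit Arguments.
Unset Strict Implicit.
Unset Printing Implicit Defensive.

Import Order.TTheory GRing.Theory Num.Theory.

Local Open Scope classical_set_scope.

(** * Generic points of ultrafilters *)

Section Ultrafilters.

Lemma near_or T (F : set_system T) (P Q : set T) : UltraFilter F ->
  F [set x | P x \/ Q x] -> F P \/ F Q.
Proof.
move=> FU PQ; have [FP|FnP] := in_ultra_setVsetC P FU; [by left|right].
by apply: filterS (filterI PQ FnP) => x [[]].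
Qed.

Lemma near_in T (I : eqType) (F : set_system T) {FF : Filter F}
    (s : seq I) (P : I -> set T) :
  (forall i, i \in s -> F (P i)) ->
  F [set x | forall i, i \in s -> P i x].
Proof.
elim: s => [_|i s IH sP]; first exact: filterE.
apply: filterS (filterI (sP i (mem_head _ _)) (IH _)) => [x [Pi Ps] j|j js].
  by rewrite in_cons => /orP[/eqP->//|]; exact: Ps.
by apply: sP; rewrite in_cons js orbT.
Qed.

Lemma ex_ultra_nat :
  exists2 U : set_system nat, UltraFilter U & forall n, U [set m | (n < m)%N].
Proof.
have [U [UU sU]] := ultraFilterLemma (eventually_filter : ProperFilter \oo).
by exists U => // n; apply: sU; exists n.+1.
Qed.

(** Each entry is chosen among the generic points that stay generic
    with respect to every entry chosen before it. *)
Lemma ex_pairwise_seq (T : eqType) (F : set_system T) (r : rel T) (Q : set T) k :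
    ProperFilter F -> F [set x | F [set y | r x y]] -> F Q ->
  exists s : seq T, [/\ size s = k, pairwise r s & forall x, x \in s -> Q x].
Proof.
move=> FF Fr FQ.
suff [s [? ? ? _]] : exists s : seq T, [/\ size s = k, pairwise r s,
    forall x, x \in s -> Q x & forall x, x \in s -> F [set y | r x y]].
  by exists s.
elim: k => [|k [s [sk sr sQ sF]]]; first by exists [::].
have [y [[Qy ry] sy]] := filter_ex (filterI (filterI FQ Fr) (near_in sF)).
exists (rcons s y); split; rewrite ?size_rcons ?sk// ?pairwise_rcons ?sr.
- by rewrite andbT; apply/allP => x /sy.
- by move=> x; rewrite mem_rcons inE => /orP[/eqP->|/sQ].
- by move=> x; rewrite mem_rcons inE => /orP[/eqP->|/sF].
Qed.

(** The blocks are drawn in the order of the quantifiers: the left block, then the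
    point, then the right block. One more entry is drawn in each block, so that the
    point is related to an entry of the other side even if the block is empty. *)
Lemma ex_block_point_block (T : eqType) (F V G : set_system T)
    (r1 r2 : rel T) (S : T -> T -> T -> Prop) m n :
    ProperFilter F -> ProperFilter V -> ProperFilter G ->
    F [set x | F [set x' | r1 x x']] ->
    G [set z | G [set z' | r2 z z']] ->
    F [set x | V [set y | G [set z | S x y z]]] ->
  exists s y t, [/\ size s = m, size t = n, pairwise r1 s, pairwise r2 t &
    [/\ forall x z, x \in s -> z \in t -> S x y z,
        forall x, x \in s -> exists z, S x y z
      & forall z, z \in t -> exists x, S x y z]].
Proof.
move=> FF FV FG Fr1 Gr2 FS.
have [[|x0 s] [] //= [sm] /andP[_ sr1] sS] := ex_pairwise_seq m.+1 FF Fr1 FS.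
have [y yS] := filter_ex (near_in sS).
have [[|z0 t] [] //= [tn] /andP[_ tr2] tS]  :=
  ex_pairwise_seq n.+1 FG Gr2 (near_in yS).
(* x0 and z0 are the extra entries. *)
exists s, y, t; split=> //; split=> [x z xs zt|x xs|z zt].
- by apply: tS; rewrite inE ?xs ?zt orbT.
- by exists z0; apply: tS; rewrite ?mem_head// inE xs orbT.
- by exists x0; apply: tS; rewrite ?mem_head// inE zt orbT.
Qed.

End Ultrafilters.

Local Open Scope ring_scope.

(** * Increasing bijections of the rationals *)

Definition ratlt : rel rat := fun x y => x < y.

Lemma ratlt_trans : transitive ratlt. Proof. by move=> y x z; exact: lt_trans. Qed.
Lemma ratlt_irr : irreflexive ratlt. Proof. by move=> x; exact: ltxx. Qed.

Definition increasing_bijection (f : rat -> rat) : Prop :=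
  bijective f /\ {homo f : x y / x < y}.

Lemma increasing_bijection_comp f g : increasing_bijection f ->
  increasing_bijection g -> increasing_bijection (f \o g).
Proof.
move=> [bf hf] [bg hg]; split; first exact: bij_comp.
by move=> x y /hg/hf.
Qed.

(** Piecewise linear maps suffice, and the inverse is obtained by exchanging e and e'. *)
Definition bump (c d e e' x : rat) : rat :=
  if (x <= c) || (d <= x) then x
  else if x <= e then c + (x - c) * ((e' - c) / (e - c))
  else d - (d - x) * ((d - e') / (d - e)).

Section Bump.
Variables c d e e' : rat.
Hypotheses (ce : c < e) (ed : e < d) (ce' : c < e') (ed' : e' < d).

Lemma bump_out x : x <= c \/ d <= x -> bump c d e e' x = x.
Proof. by rewrite /bump => -[|] ->; rewrite ?orbT. Qed.

Lemma bump_at : bump c d e e' e = e'.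
Proof.
have ec : e - c != 0 by rewrite gt_eqF ?subr_gt0.
by rewrite /bump !leNgt ce ed /= ltxx /= mulrCA divff// mulr1 addrC subrK.
Qed.

End Bump.

Lemma bumpK c d e e' : c < e -> e < d -> c < e' -> e' < d ->
  cancel (bump c d e e') (bump c d e' e).
Proof.
move=> ce ed ce' ed' x.
have a0 : 0 < e - c by lra.
have b0 : 0 < e' - c by lra.
have a1 : 0 < d - e by lra.
have b1 : 0 < d - e' by lra.
have [xo|xi] := boolP ((x <= c) || (d <= x)).
  by move/orP: (xo) => xo'; rewrite !bump_out//.
rewrite {2}/bump (negbTE xi); move: xi; rewrite negb_or -!ltNge => /andP[cx xd].
have [xe|xe] := leP x e.
- set y := _ + _.
  have yc : y - c = (x - c) * ((e' - c) / (e - c)) by rewrite /y; ring.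
  have q0 : 0 < (e' - c) / (e - c) by rewrite divr_gt0.
  have y1 : c < y by rewrite -subr_gt0 yc mulr_gt0 ?subr_gt0.
  have y2 : y <= e'.
    suff : y - c <= e' - c by lra.
    rewrite yc; apply: (@le_trans _ _ ((e - c) * ((e' - c) / (e - c)))).
      by rewrite ler_wpM2r ?(ltW q0) ?lerD2r.
    by rewrite mulrCA divff ?mulr1 ?gt_eqF.
  have yd : y < d by lra.
  rewrite /bump !leNgt y1 yd /= -leNgt y2 yc; field.
  by rewrite !gt_eqF.
- set y := _ - _.
  have yc : d - y = (d - x) * ((d - e') / (d - e)) by rewrite /y; ring.
  have q0 : 0 < (d - e') / (d - e) by rewrite divr_gt0.
  have y1 : y < d by rewrite -subr_gt0 yc mulr_gt0 ?subr_gt0.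
  have y2 : e' < y.
    suff : d - y < d - e' by lra.
    rewrite yc; apply: (@lt_le_trans _ _ ((d - e) * ((d - e') / (d - e)))).
      by rewrite ltr_pM2r// ltrD2l ltrN2.
    by rewrite mulrCA divff ?mulr1 ?gt_eqF.
  have yc' : c < y by lra.
  rewrite /bump !leNgt y1 yc' /= y2 /= yc; field.
  by rewrite !gt_eqF.
Qed.

Lemma bump_homo c d e e' : c < e -> e < d -> c < e' -> e' < d ->
  {homo bump c d e e' : x y / x < y}.
Proof.
move=> ce ed ce' ed' x y xy.
have p0 : 0 < (e' - c) / (e - c) by rewrite divr_gt0 ?subr_gt0.
have q0 : 0 < (d - e') / (d - e) by rewrite divr_gt0 ?subr_gt0.
pose l u := c + (u - c) * ((e' - c) / (e - c)).
pose r u := d - (d - u) * ((d - e') / (d - e)).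
have lh u v : u < v -> l u < l v by move=> uv; rewrite ltrD2l ltr_pM2r// ltrD2r.
have rh u v : u < v -> r u < r v.
  by move=> uv; rewrite ltrD2l ltrN2 ltr_pM2r// ltrD2l ltrN2.
have lc : l c = c by rewrite /l subrr mul0r addr0.
have rd : r d = d by rewrite /r subrr mul0r subr0.
have le : l e = e'.
  by rewrite /l mulrCA divff ?mulr1 ?gt_eqF ?subr_gt0// addrC subrK.
have re : r e = e'.
  by rewrite /r mulrCA divff ?mulr1 ?gt_eqF ?subr_gt0// opprB addrC subrK.
have lE u : c < u -> u <= e -> c < l u <= e'.
  move=> cu; have := lh _ _ cu; rewrite lc => ->.
  rewrite le_eqVlt => /orP[/eqP->|/lh]; rewrite le ?lexx//.
  exact: ltW.
have rE u : e < u -> u < d -> e' < r u < d.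
  by move=> eu ud; have := rh _ _ eu; have := rh _ _ ud; rewrite re rd => -> ->.
rewrite /bump -/(l x) -/(l y) -/(r x) -/(r y).
have := lE x; have := lE y; have := rE x; have := rE y.
have := lh x y xy; have := rh x y xy.
move: (l x) (l y) (r x) (r y) => lx ly rx ry lxy rxy.
case: (leP x c) => xc; case: (leP d x) => dx; case: (leP y c) => yc;
  case: (leP d y) => dy; case: (leP x e) => xe; case: (leP y e) => ye //=;
  try (exfalso; lra); move=> Hry Hrx Hly Hlx;
  try (have {Hry} := Hry isT isT); try (have {Hrx} := Hrx isT isT);
  try (have {Hly} := Hly isT isT); try (have {Hlx} := Hlx isT isT);
  do ?[move=> /andP[]]; lra.
Qed.

Lemma bump_increasing c d e e' : c < e -> e < d -> c < e' -> e' < d ->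
  increasing_bijection (bump c d e e').
Proof.
move=> ce ed ce' ed'; split; last exact: bump_homo.
by exists (bump c d e' e); exact: bumpK.
Qed.

Lemma ex_gap_below (t : seq rat) m : (forall z, z \in t -> z < m) ->
  exists c, c < m /\ forall z, z \in t -> z <= c.
Proof.
elim: t => [|a t IH] tm; first by exists (m - 1); split=> //; lra.
have [z zt|c [cm tc]] := IH; first by apply: tm; rewrite inE zt orbT.
exists (Num.max a c); rewrite gt_max cm tm ?mem_head//; split=> // z.
by rewrite inE le_max => /orP[/eqP->|/tc->]; rewrite ?lexx ?orbT.
Qed.

(** By induction on the length: a bump supported above all other entries of the
    target moves the last entry to its place. *)
Lemma ex_increasing_bijection (s t : seq rat) : size s = size t ->
    sorted ratlt s -> sorted ratlt t ->
  exists2 f, increasing_bijection f & map f s = t.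
Proof.
rewrite !(sorted_pairwise ratlt_trans).
elim/last_ind: s t => [|s x IH] t.
  by move=> /esym/size0nil-> _ _; exists id => //; split=> //; exists id.
elim/last_ind: t => [|t y _]; first by rewrite size_rcons.
rewrite !size_rcons !pairwise_rcons => -[] st /andP[/allP sx ps] /andP[/allP ty pt].
have [f [bf fh] fst] := IH t st ps pt.
have tfx z : z \in t -> z < f x by rewrite -fst => /mapP[w /sx wx ->]; exact: fh.
have [c [cm tc]] : exists c, c < Num.min (f x) y /\ forall z, z \in t -> z <= c.
  by apply: ex_gap_below => z zt; rewrite lt_min tfx//=; exact: ty.
move: cm; rewrite lt_min => /andP[cfx cy].
have dfx : f x < Num.max (f x) y + 1 by rewrite ltr_pwDr// le_max lexx.
have dy : y < Num.max (f x) y + 1 by rewrite ltr_pwDr// le_max lexx orbT.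
set d := (_ + 1) in dfx dy.
exists (bump c d (f x) y \o f).
  by apply: increasing_bijection_comp => //; exact: bump_increasing.
rewrite map_rcons /= bump_at// map_comp fst; congr rcons.
by rewrite -[RHS]map_id; apply/eq_in_map => z /tc zc; rewrite bump_out//; left.
Qed.

(** * Rearrangements of increasing sequences *)

Lemma ex_insertion (T : eqType) (r : rel T) (s : seq T) b : transitive r ->
    (forall x, x \in s -> r x b \/ r b x) -> pairwise r s ->
  exists L M, s = L ++ M /\ pairwise r (L ++ b :: M).
Proof.
move=> rtr; elim: s => [_ _|a s IH sb]; first by exists [::], [::].
move=> /= /andP[/allP ra rs].
have [ab|ba] := sb a (mem_head _ _); last first.
  exists [::], (a :: s); split=> //=; rewrite ba rs /= andbT; apply/andP; split.
    by apply/allP => x /ra; exact: rtr.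
  exact/allP.
have [|L [M [sLM p]]] := IH _ rs; first by move=> x xs; apply: sb; rewrite inE xs orbT.
exists (a :: L), M; split; first by rewrite sLM.
rewrite /= p andbT; apply/allP => x.
rewrite mem_cat inE => /or3P[xL|/eqP->//|xM]; apply: ra; rewrite sLM mem_cat.
  by rewrite xL.
by rewrite xM orbT.
Qed.

Section GoodSequences.
Variable K : set (rat -> rat).
Hypothesis Kcomp : forall f g, K f -> K g -> K (f \o g).
Hypothesis Kinj : forall f, K f -> injective f.
Hypothesis Kinc : forall f, increasing_bijection f -> K f.

(** All increasing sequences of a given length are in one K-orbit, as K contains the
    increasing bijections; good sequences are those of that orbit. *)
Definition good (s : seq rat) : Prop := exists2 k, K k & sorted ratlt (map k s).

Lemma good_map k s : K k -> good (map k s) -> good s.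
Proof.
by move=> Kk [k' Kk' ks]; exists (k' \o k); [exact: Kcomp|rewrite map_comp].
Qed.

Lemma good_sorted s : sorted ratlt s -> good s.
Proof.
move=> ss; exists id; last by rewrite map_id.
by apply: Kinc; split=> //; exists id.
Qed.

(** Rearranging positions commutes with K, so a rearrangement that keeps the
    increasing sequences good keeps all good sequences good. *)
Lemma good_suffix_rev :
    (forall X Y, sorted ratlt (X ++ Y) -> good (X ++ rev Y)) ->
  forall X Y, good (X ++ Y) -> good (X ++ rev Y).
Proof.
move=> srev X Y [k Kk]; rewrite map_cat => /srev.
by rewrite -map_rev -map_cat; exact: good_map.
Qed.

Lemma good_prefix_rev :
    (forall X Y, sorted ratlt (X ++ Y) -> good (rev X ++ Y)) ->
  forall X Y, good (X ++ Y) -> good (rev X ++ Y).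
Proof.
move=> prev X Y [k Kk]; rewrite map_cat => /prev.
by rewrite -map_rev -map_cat; exact: good_map.
Qed.

Lemma good_rev : (forall X, sorted ratlt X -> good (rev X)) ->
  forall X, good X -> good (rev X).
Proof.
move=> grev X [k Kk /grev]; rewrite -map_rev; exact: good_map.
Qed.

(** Insertion sort: once the entries before the last one are in increasing order,
    the last one is carried back to its place. *)
Lemma all_good_of_last :
    (forall L b M, sorted ratlt (L ++ b :: M) -> good (L ++ rcons M b)) ->
  forall s, uniq s -> good s.
Proof.
move=> gl; elim/last_ind => [|s a IH]; first by move=> _; exact: good_sorted.
rewrite rcons_uniq => /andP[as_ /IH[k Kk ks]].
have [x xs||L [M [sLM p]]] := @ex_insertion _ ratlt (map k s) (k a) ratlt_trans.
- have : x != k a.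
    by apply: contra as_ => /eqP xk; move: xs; rewrite xk mem_map//; exact: Kinj.
  by rewrite /ratlt; case: ltgtP => //; [left|right].
- by rewrite -sorted_pairwise//; exact: ratlt_trans.
apply: (@good_map k) => //; rewrite map_rcons sLM rcons_cat; apply: gl.
by rewrite sorted_pairwise//; exact: ratlt_trans.
Qed.

Lemma all_good_of_first :
    (forall L b M, sorted ratlt (L ++ b :: M) -> good (b :: L ++ M)) ->
  forall s, uniq s -> good s.
Proof.
move=> gl; elim=> [|a s IH]; first by move=> _; exact: good_sorted.
rewrite cons_uniq => /andP[as_ /IH[k Kk ks]].
have [x xs||L [M [sLM p]]] := @ex_insertion _ ratlt (map k s) (k a) ratlt_trans.
- have : x != k a.
    by apply: contra as_ => /eqP xk; move: xs; rewrite xk mem_map//; exact: Kinj.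
  by rewrite /ratlt; case: ltgtP => //; [left|right].
- by rewrite -sorted_pairwise//; exact: ratlt_trans.
apply: (@good_map k) => //; rewrite map_cons sLM; apply: gl.
by rewrite sorted_pairwise//; exact: ratlt_trans.
Qed.

Definition all_good := forall s, uniq s -> good s.

(** Reversing the suffix M and then the suffix b (rev M) carries b across M. *)
Lemma all_good_of_suffix_rev :
  (forall X Y, sorted ratlt (X ++ Y) -> good (X ++ rev Y)) -> all_good.
Proof.
move=> /good_suffix_rev srev; apply: all_good_of_last => L b M /good_sorted.
rewrite -cat_rcons => /srev; rewrite cat_rcons => /srev.
by rewrite rev_cons revK.
Qed.

Lemma all_good_of_prefix_rev :
  (forall X Y, sorted ratlt (X ++ Y) -> good (rev X ++ Y)) -> all_good.
Proof.
move=> /good_prefix_rev prev; apply: all_good_of_first => L b M /good_sorted.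
move=> /prev; rewrite -cat_rcons => /prev.
by rewrite rev_rcons revK.
Qed.

(** With X empty the hypothesis yields the reversal of all good sequences, and
    composing with it gives a case treated above. *)
Lemma all_good_of_rev_swap :
  (forall X Y, sorted ratlt (X ++ Y) -> good (rev Y ++ X)) -> all_good.
Proof.
move=> swap; have grev : forall X, good X -> good (rev X).
  by apply: good_rev => X sX; have := swap [::] X sX; rewrite cats0.
by apply: all_good_of_prefix_rev => X Y /swap/grev; rewrite rev_cat revK.
Qed.

Lemma all_good_of_swap_rev :
  (forall X Y, sorted ratlt (X ++ Y) -> good (Y ++ rev X)) -> all_good.
Proof.
move=> swap; have grev : forall X, good X -> good (rev X).
  by apply: good_rev => X sX; have := swap X [::]; rewrite cats0; exact.
by apply: all_good_of_suffix_rev => X Y /swap/grev; rewrite rev_cat revK.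
Qed.

(** With X empty the hypothesis yields the cyclic rotations, and these bring the
    prefix Z of Z b X back to the end. *)
Lemma all_good_of_reverse_blocks :
    (forall X b Z, sorted ratlt (X ++ b :: Z) -> good (Z ++ b :: X)) -> all_good.
Proof.
move=> rb; have rot1 b Z : good (b :: Z) -> good (rcons Z b).
  move=> [k Kk /= ks]; apply: (@good_map k) => //; rewrite map_rcons -cats1.
  exact: (rb [::]).
have rotn A B : good (A ++ B) -> good (B ++ A).
  elim: A B => [|a A IH] B; first by rewrite cats0.
  by move=> /rot1; rewrite rcons_cat => /IH; rewrite cat_rcons.
by apply: all_good_of_first => X b Z /rb/rotn.
Qed.

(** Good rearrangements may be tested on a single increasing sequence, as any two
    are exchanged by an increasing bijection. *)
Lemma ex_transfer X Y X' Y' : size X = size X' -> size Y = size Y' ->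
    sorted ratlt (X ++ Y) -> sorted ratlt (X' ++ Y') ->
  exists2 f, K f & map f X = X' /\ map f Y = Y'.
Proof.
move=> sX sY sXY sXY'.
have [|f /Kinc Kf] := ex_increasing_bijection _ sXY sXY'.
  by rewrite !size_cat sX sY.
rewrite map_cat => /eqP; rewrite eqseq_cat ?size_map// => /andP[/eqP ? /eqP ?].
by exists f.
Qed.

End GoodSequences.

(** * Behaviour near cuts, and the separation relation *)

(** The circular order obtained by joining the two ends of the line. *)
Definition cyc (x y z : rat) : bool :=
  [|| (x < y) && (y < z), (y < z) && (z < x) | (z < x) && (x < y)].

(** The separation relation of the circle: z and w lie on different arcs between x
    and y. *)
Definition sep (x y z w : rat) : bool :=
  (cyc x z y && cyc y w x) || (cyc x w y && cyc y z x).

Lemma cyc_rot x y z : cyc x y z = cyc y z x.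
Proof. by rewrite /cyc orbC -orbA. Qed.

Lemma cyc_trans x y z w : cyc x y z -> cyc x z w -> cyc x y w.
Proof.
by rewrite /cyc => /or3P[]/andP[? ?] /or3P[]/andP[? ?]; apply/or3P;
   first [apply: Or31; lra|apply: Or32; lra|apply: Or33; lra|exfalso; lra].
Qed.

Lemma cyc_insert x y z w : cyc x y z -> cyc x z w -> cyc y z w.
Proof.
by rewrite /cyc => /or3P[]/andP[? ?] /or3P[]/andP[? ?]; apply/or3P;
   first [apply: Or31; lra|apply: Or32; lra|apply: Or33; lra|exfalso; lra].
Qed.

Lemma cyc_inside x y z w : cyc x y z -> cyc y w z -> cyc x y w /\ cyc x w z.
Proof.
by rewrite /cyc => /or3P[]/andP[? ?] /or3P[]/andP[? ?]; split; apply/or3P;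
   first [apply: Or31; lra|apply: Or32; lra|apply: Or33; lra|exfalso; lra].
Qed.

Lemma ex_left_ultrafilters : exists F : rat -> set_system rat,
  (forall c, UltraFilter (F c)) /\
  (forall c d, d < c -> F c [set x | d < x /\ x < c]).
Proof.
have /choice[F FP] (c : rat) : exists F : set_system rat,
    UltraFilter F /\ forall d, d < c -> F [set x | d < x /\ x < c].
  pose B d := [set x | d < x /\ x < c].
  have FB : ProperFilter (filter_from [set d | d < c] B).
    apply: filter_from_proper => [|d /= dc]; last first.
      by exists ((d + c) / 2); rewrite /B /=; split; lra.
    apply: filter_from_filter => [|d d' /= dc dc']; first by exists (c - 1) => /=; lra.
    exists (Num.max d d'); first by rewrite /= gt_max dc.
    by move=> x [/=]; rewrite gt_max => /andP[]; split; split.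
  have [U [UU sU]] := ultraFilterLemma FB.
  by exists U; split=> // d dc; apply: sU; exists d.
by exists F; split=> c; have [] := FP c.
Qed.

(** In this section K is the group acting on the rationals, and F c is an
    ultrafilter converging to c from the left; a point is generic below c if it
    satisfies the properties that hold F c-almost everywhere. *)
Section Dichotomy.
Variable K : set (rat -> rat).
Hypothesis Kcomp : forall f g, K f -> K g -> K (f \o g).
Hypothesis Kinj : forall f, K f -> injective f.
Hypothesis Kinc : forall f, increasing_bijection f -> K f.

Variable F : rat -> set_system rat.
Hypothesis FU : forall c, UltraFilter (F c).
Hypothesis Fleft : forall c d, d < c -> F c [set x | d < x /\ x < c].

Local Instance F_ultra c : UltraFilter (F c) := FU c.

Lemma near_lt_left c d : c < d ->
  F c [set x | F d [set y | x < y]].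
Proof.
move=> cd; have c1 : c - 1 < c by lra.
apply: filterS (Fleft c1) => x [_ xc].
by apply: filterS (Fleft cd) => y [cy _] /=; exact: lt_trans cy.
Qed.

Lemma near_lt_self c : F c [set x | F c [set y | x < y]].
Proof.
have c1 : c - 1 < c by lra.
apply: filterS (Fleft c1) => x [_ xc].
by apply: filterS (Fleft xc) => y [].
Qed.

(** With c = d, the sign e says whether g increases or decreases along generic points
    below c; with c < d, it compares the images of the points below c to those of the
    points below d. *)
Definition monotone_at (e : bool) (g : rat -> rat) (c d : rat) : Prop :=
  F c [set x | F d [set y | if e then g x < g y else g y < g x]].

Lemma monotone_at_ex g c d : injective g -> c <= d -> exists e, monotone_at e g c d.
Proof.
move=> ginj cd.
have lt_cd : F c [set x | F d [set y | x < y]].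
  by move: cd; rewrite le_eqVlt => /orP[/eqP->|/near_lt_left//]; exact: near_lt_self.
suff /near_or[H|H] : F c [set x | F d [set y | g x < g y] \/ F d [set y | g y < g x]].
- by exists true.
- by exists false.
apply: filterS lt_cd => x Fx; apply: near_or; apply: filterS Fx => y xy.
have : g x != g y by apply: contra_ltN xy => /eqP/ginj->.
by rewrite neq_lt => /orP[]; [left|right].
Qed.

Section OneFunction.
(* Besides the elements g of K, this covers - g when reversals preserve good
   sequences. *)
Variable g : rat -> rat.
Hypothesis ginj : injective g.
Hypothesis ggood : forall s, sorted ratlt (map g s) -> good K s.

Definition orient (e : bool) (s : seq rat) := if e then s else rev s.

Lemma sorted_orient e s :
  pairwise [rel x y | (x < y) && (if e then g x < g y else g y < g x)] s ->
  pairwise ratlt s /\ pairwise (relpre g ratlt) (orient e s).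
Proof.
rewrite pairwise_relI => /andP[ps gs]; split=> //; case: e gs => //= gs.
have tr : transitive (fun x y => g y < g x) by move=> y x z xy yz; exact: lt_trans xy.
rewrite -sorted_pairwise ?rev_sorted; last by move=> y x z; exact: lt_trans.
by rewrite sorted_pairwise.
Qed.

(** Two blocks of generic points, one below c and one below d, are put by g in one of
    eight arrangements, according to the three signs. As increasing sequences of the
    same length are in one orbit, such a sample decides about all X and Y. *)
Lemma good_two_blocks e1 e2 r c d : c < d ->
    monotone_at e1 g c c -> monotone_at e2 g d d -> monotone_at r g c d ->
  forall X Y, sorted ratlt (X ++ Y) ->
    good K (if r then orient e1 X ++ orient e2 Y else orient e2 Y ++ orient e1 X).
Proof.
move=> cd m1 m2 mr X Y sXY.
pose ord e := [rel x y : rat | (x < y) && (if e then g x < g y else g y < g x)].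
have mono e z : monotone_at e g z z -> F z [set x | F z [set x' | ord e x x']].
  move=> me; apply: filterS (filterI (near_lt_self z) me) => x [/= Fx Gx].
  by apply: filterS (filterI Fx Gx) => y [/= -> ->].
have Fr : F c [set x | F c [set y | F d [set z | ord r x z]]].
  apply: filterS (filterI (near_lt_left cd) mr) => x [/= Fx Gx].
  apply: filterE => y.
  by apply: filterS (filterI Fx Gx) => z [/= -> ->].
have [s [y [t [sX sY /sorted_orient[s1 s2] /sorted_orient[t1 t2] [st _ _]]]]] :=
  @ex_block_point_block _ (F c) (F c) (F d) (ord e1) (ord e2)
    (fun x _ z => ord r x z) (size X) (size Y) _ _ _
    (mono _ _ m1) (mono _ _ m2) Fr.
have sst : sorted ratlt (s ++ t).
  rewrite sorted_pairwise; last exact: ratlt_trans.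
  rewrite pairwise_cat s1 t1 !andbT; apply/allrelP => x z xs zt.
  by have /andP[] := st x z xs zt.
have [f Kf [fX fY]] := ex_transfer Kinc (esym sX) (esym sY) sXY sst.
apply: (good_map Kcomp Kf).
have mo e Z : map f (orient e Z) = orient e (map f Z) by case: e => //=; rewrite map_rev.
have -> : map f (if r then orient e1 X ++ orient e2 Y else orient e2 Y ++ orient e1 X)
    = if r then orient e1 s ++ orient e2 t else orient e2 t ++ orient e1 s.
  by case: (r); rewrite map_cat !mo fX fY.
apply: ggood; rewrite sorted_map sorted_pairwise; last by move=> ? ? ?; exact: lt_trans.
have mem_orient e Z : orient e Z =i Z by move=> x; case: e => //=; rewrite mem_rev.
clear mr Fr; case: r st => st; rewrite pairwise_cat s2 t2 !andbT; apply/allrelP => x z.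
  by rewrite !mem_orient => xs zt; have /andP[] := st x z xs zt.
by rewrite !mem_orient => xs zt; have /andP[] := st z x zt xs.
Qed.

Lemma all_good_of_signs e c d : c < d ->
  monotone_at e g c c -> monotone_at (~~ e) g d d -> all_good K.
Proof.
move=> cd m1 m2; have [r mr] := monotone_at_ex ginj (ltW cd).
have /= := good_two_blocks cd m1 m2 mr.
case: e r {mr} m1 m2 => -[] /= _ _.
- exact: all_good_of_suffix_rev.
- exact: all_good_of_rev_swap.
- exact: all_good_of_prefix_rev.
- exact: all_good_of_swap_rev.
Qed.

Lemma good_rev_of_sign c d X : c < d ->
  monotone_at false g c c -> monotone_at false g d d -> sorted ratlt X -> good K (rev X).
Proof.
move=> cd m1 m2 sX; have [r mr] := monotone_at_ex ginj (ltW cd).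
have := good_two_blocks cd m1 m2 mr (X := X) (Y := [::]).
by rewrite cats0 /orient => /(_ sX); rewrite [rev [::]]/= cats0; case: (r).
Qed.

Definition near3 (c d : rat) (V : set_system rat)
    (P : rat -> rat -> rat -> Prop) : Prop :=
  F c [set x | V [set y | F d [set z | P x y z]]].

Lemma near3_or c d V P Q : UltraFilter V ->
  near3 c d V (fun x y z => P x y z \/ Q x y z) -> near3 c d V P \/ near3 c d V Q.
Proof.
move=> VU nPQ; apply: near_or; apply: filterS nPQ => x xPQ.
by apply: near_or; apply: filterS xPQ => y; exact: near_or.
Qed.

Lemma near3_lt c d V : c < d -> UltraFilter V -> V [set y | c <= y /\ y < d] ->
  near3 c d V (fun x y z => x < y < z).
Proof.
move=> cd VU Vcd; have c1 : c - 1 < c by lra.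
apply: filterS (Fleft c1) => x [_ xc].
apply: filterS Vcd => y [cy yd].
by apply: filterS (Fleft yd) => z [yz _] /=; rewrite yz (lt_le_trans xc).
Qed.

(** The sequence X b Z is mapped onto a generic block below c, a V-generic point and
    a generic block below d. Typically V is principal or is an F u with u between c
    and d. *)
Lemma ex_block_point_block_transfer c d V (S : rat -> rat -> rat -> bool) X b Z :
    UltraFilter V -> monotone_at true g c c -> monotone_at true g d d ->
    near3 c d V (fun x y z => x < y < z /\ S (g x) (g y) (g z)) ->
    sorted ratlt (X ++ b :: Z) ->
  exists2 f, K f &
    [/\ pairwise (relpre (g \o f) ratlt) X, pairwise (relpre (g \o f) ratlt) Z
      & [/\ forall x z, x \in X -> z \in Z -> S (g (f x)) (g (f b)) (g (f z)),
            forall x, x \in X -> exists z, S (g (f x)) (g (f b)) z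
          & forall z, z \in Z -> exists x, S x (g (f b)) (g (f z))]].
Proof.
move=> VU m1 m2 near sXZ; pose ord := [rel x y : rat | (x < y) && (g x < g y)].
have mono z : monotone_at true g z z -> F z [set x | F z [set x' | ord x x']].
  move=> me; apply: filterS (filterI (near_lt_self z) me) => x [/= Fx Gx].
  by apply: filterS (filterI Fx Gx) => y [/= -> ->].
have [s [y [t [sX sZ]]]] := @ex_block_point_block _ (F c) V (F d) ord ord
  _ (size X) (size Z) _ _ _ (mono _ m1) (mono _ m2) near.
rewrite !pairwise_relI => /andP[s1 s2] /andP[t1 t2] [stS sS tS].
have syt : sorted ratlt (s ++ y :: t).
  rewrite sorted_pairwise; last exact: ratlt_trans.
  rewrite pairwise_cat s1 /= t1 !andbT; apply/andP; split.
    apply/allrelP => x z xs; have [z' [/andP[xy _] _]] := sS x xs.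
    rewrite inE => /orP[/eqP->//|zt]; have [x' [/andP[_ yz] _]] := tS z zt.
    exact: lt_trans xy yz.
  by apply/allP => z zt; have [x' [/andP[_ yz] _]] := tS z zt.
have sbZ : size (b :: Z) = size (y :: t) by rewrite /= sZ.
have [f Kf [fX [fb fZ]]] := ex_transfer Kinc (esym sX) sbZ sXZ syt.
exists f => //; rewrite fb; split; rewrite -?(pairwise_map f (relpre g ratlt)) ?fX ?fZ//.
split.
- move=> x z xX zZ; have [||_ ] // := stS (f x) (f z); first by rewrite -fX map_f.
  by rewrite -fZ map_f.
- move=> x xX; have [|z [_ Sz]] := sS (f x); first by rewrite -fX map_f.
  by exists (g z).
- move=> z zZ; have [|x [_ Sx]] := tS (f z); first by rewrite -fZ map_f.
  by exists (g x).
Qed.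

(** If the images are generically not in circular order, then g carries the middle
    point across one of the two blocks, or exchanges the blocks around it; in each
    case all sequences would be good. *)
Lemma near3_cyc c d V : c < d -> UltraFilter V -> V [set y | c <= y /\ y < d] ->
    monotone_at true g c c -> monotone_at true g d d -> ~ all_good K ->
  near3 c d V (fun x y z => cyc (g x) (g y) (g z)).
Proof.
move=> cd VU Vcd m1 m2 nall.
have n3lt := near3_lt cd VU Vcd.
have n3 : near3 c d V (fun x y z => cyc (g x) (g y) (g z) \/
    (x < y < z /\ g x < g z < g y) \/ (x < y < z /\ g y < g x < g z) \/
    (x < y < z /\ g z < g y < g x)).
  apply: filterS n3lt => x /=; apply: filterS => y /=; apply: filterS => z /= /andP[xy yz].
  have xz := lt_trans xy yz; rewrite xy yz /cyc.
  have : g x != g y by apply: contra_ltN xy => /eqP/ginj->.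
  have : g y != g z by apply: contra_ltN yz => /eqP/ginj->.
  have : g x != g z by apply: contra_ltN xz => /eqP/ginj->.
  by case: (ltgtP (g x) (g y)) => //; case: (ltgtP (g y) (g z)) => //;
     case: (ltgtP (g x) (g z)) => //= *; tauto.
have good_im f s : K f -> pairwise (relpre (g \o f) ratlt) s -> good K s.
  move=> Kf p; apply: (good_map Kcomp Kf); apply: ggood.
  by rewrite -map_comp sorted_pairwise ?pairwise_map//; exact: ratlt_trans.
have [//|/near3_or[|/near3_or[]]] := near3_or VU n3 => {}n3; case: nall.
- apply: (all_good_of_last Kcomp Kinj Kinc) => L b M sLM.
  have [f Kf [pL pM [LM Lb Mb]]] := ex_block_point_block_transfer
    (S := fun x y z => x < z < y) VU m1 m2 n3 sLM.
  apply: (good_im f) => //; rewrite pairwise_cat pairwise_rcons pL pM !andbT.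
  apply/andP; split; last by apply/allP => z /Mb[x /andP[]].
  apply/allrelP => x z xL; rewrite mem_rcons inE => /orP[/eqP->|zM].
    by have [z' /andP[]] := Lb x xL; exact: lt_trans.
  by have /andP[] := LM x z xL zM.
- apply: (all_good_of_first Kcomp Kinj Kinc) => L b M sLM.
  have [f Kf [pL pM [LM Lb Mb]]] := ex_block_point_block_transfer
    (S := fun x y z => y < x < z) VU m1 m2 n3 sLM.
  apply: (good_im f) => //=; rewrite pairwise_cat pL pM !andbT.
  apply/andP; split; last by apply/allrelP => x z xL zM; have /andP[] := LM x z xL zM.
  apply/allP => x; rewrite mem_cat => /orP[/Lb[z /andP[]]//|/Mb[z /andP[]]].
  exact: lt_trans.
- apply: (all_good_of_reverse_blocks Kcomp Kinj Kinc) => L b M sLM.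
  have [f Kf [pL pM [LM Lb Mb]]] := ex_block_point_block_transfer
    (S := fun x y z => z < y < x) VU m1 m2 n3 sLM.
  have bL x : x \in L -> g (f b) < g (f x) by move=> /Lb[z /andP[]].
  have Mb' z : z \in M -> g (f z) < g (f b) by move=> /Mb[z' /andP[]].
  apply: (good_im f) => //; rewrite pairwise_cat /= pL pM !andbT.
  apply/andP; split; last by apply/allP.
  apply/allrelP => z x zM; rewrite inE => /orP[/eqP->|xL]; first exact: Mb'.
  exact: lt_trans (Mb' z zM) (bL x xL).
Qed.

(** The images of generic points below a1, a2, a3 and a3 + 1 cut the circle into arcs
    that occur in the right circular order and contain g a1, g a2 and g a3. *)
Lemma cyc_homo : (forall c, monotone_at true g c c) -> ~ all_good K ->
  forall a1 a2 a3, cyc a1 a2 a3 -> cyc (g a1) (g a2) (g a3).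
Proof.
move=> mono nall; suff lt_case a1 a2 a3 : a1 < a2 < a3 -> cyc (g a1) (g a2) (g a3).
  move=> a1 a2 a3 /or3P[] /lt_case//; first by rewrite -cyc_rot.
  by rewrite cyc_rot.
move=> /andP[a12 a23]; pose d := a3 + 1; have a3d : a3 < d by rewrite /d; lra.
have a13 := lt_trans a12 a23; have a2d := lt_trans a23 a3d; have a1d := lt_trans a12 a2d.
have n3 c e V : c < e -> UltraFilter V -> V [set y | c <= y /\ y < e] ->
    near3 c e V (fun x y z => cyc (g x) (g y) (g z)).
  by move=> ce VU Ve; exact: near3_cyc.
have point c y e : c <= y -> y < e ->
    F c [set x | F e [set z | cyc (g x) (g y) (g z)]].
  move=> cy ye; have PU := principal_filter_ultra y.
  have py : principal_filter y [set u | c <= u /\ u < e] by exact/principal_filterP.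
  by apply: filterS (n3 _ _ _ (le_lt_trans cy ye) PU py) => x /principal_filterP.
have between c u e : c < u -> u < e -> near3 c e (F u) (fun x y z => cyc (g x) (g y) (g z)).
  move=> cu ue; apply: n3; first exact: lt_trans ue.
  by apply: filterS (Fleft cu) => y [cy yu]; split; [exact: ltW|exact: lt_trans ue].
have [b0 [H1 [H2 H3]]] := filter_ex (filterI (point _ _ _ (lexx a1) a12)
  (filterI (between _ _ _ a12 a23) (between _ _ _ a13 a3d))).
have [b1 [b01 [b012 H4]]] := filter_ex
  (filterI H1 (filterI H2 (point _ _ _ (lexx a2) a23))).
have [b2 [[b012' b12] [b023 H6]]] := filter_ex
  (filterI (filterI b012 H4) (filterI H3 (point _ _ _ (lexx a3) a3d))).
have [b3 [b0123 b23]] := filter_ex (filterI b023 H6).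
have [b01a2 b0a2] := cyc_inside b012' b12.
have [b02a3 _] := cyc_inside b0123 b23.
exact: cyc_insert (cyc_trans b01 b01a2) (cyc_trans b0a2 b02a3).
Qed.

End OneFunction.

Lemma cycN x y z : cyc (- x) (- y) (- z) = cyc z y x.
Proof. by rewrite /cyc !ltrN2; case: (y < x); case: (z < y); case: (x < z). Qed.

(** The sign of g is the same below all rationals. If it is positive, g preserves the
    circular order; if it is negative, g reverses it. *)
Lemma sep_homo g : ~ all_good K -> K g ->
  forall x y z w, sep x y z w -> sep (g x) (g y) (g z) (g w).
Proof.
move=> nall Kg; have ginj := Kinj Kg.
have ggood s : sorted ratlt (map g s) -> good K s by exists g.
have [mono|] := pselect (forall c, monotone_at true g c c).
  have H := cyc_homo ginj ggood mono nall.
  by move=> x y z w /orP[]/andP[/H u /H v]; rewrite /sep u v /= ?orbT.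
move=> /existsNP[c nmc].
have ne c1 c2 e : monotone_at e g c1 c1 -> monotone_at (~~ e) g c2 c2 -> False.
  move=> m1 m2; apply: nall; case: (ltgtP c1 c2) => c12.
  - exact: (all_good_of_signs ginj ggood c12 m1 m2).
  - by apply: (all_good_of_signs ginj ggood c12 m2); rewrite negbK.
  - subst c2; have [x [xf]] := filter_ex (filterI m1 m2).
    move=> xf'; have [y []] := filter_ex (filterI xf xf').
    by case: (e) => /=; case: ltgtP.
have mc : monotone_at false g c c.
  by have [[] //] := monotone_at_ex ginj (lexx c).
have mono d : monotone_at false g d d.
  by have [[] // md] := monotone_at_ex ginj (lexx d); have [] := ne _ _ _ md mc.
(* All signs are negative: reversals of blocks occur, so - g may replace g. *)
have grev : forall X, good K X -> good K (rev X).
  apply: good_rev => // X sX; have c1 : c < c + 1 by lra.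
  exact: (good_rev_of_sign ginj ggood c1 (mono _) (mono _) sX).
pose h x := - g x.
have hinj : injective h by move=> x y /oppr_inj/ginj.
have hgood s : sorted ratlt (map h s) -> good K s.
  move=> hs; apply: (good_map Kcomp Kg); rewrite -[map _ _]revK; apply: grev.
  apply: good_sorted => //; rewrite rev_sorted sorted_map.
  rewrite sorted_map in hs; apply: sub_sorted hs => x y /=.
  by rewrite /ratlt /h ltrN2.
have hmono d : monotone_at true h d d.
  apply: filterS (mono d) => x; apply: filterS => y /=.
  by rewrite /h ltrN2.
have H x y z : cyc x y z -> cyc (g z) (g y) (g x).
  by move=> /(cyc_homo hinj hgood hmono nall); rewrite cycN.
move=> x y z w /orP[]/andP[/H u /H v]; rewrite /sep.
  by rewrite u v orbT.
by rewrite u v.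
Qed.

End Dichotomy.

(** * A dense order whose automorphisms belong to the group *)

Section SortedSeq.
Variables (T : eqType) (r : rel T).
Hypotheses (rtr : transitive r) (rirr : irreflexive r).

Lemma sorted_subseq_of_mem s t : pairwise r s -> pairwise r t ->
  {subset s <= t} -> subseq s t.
Proof.
move=> ps pt st; have -> : s = [seq x <- t | x \in s]; last exact: filter_subseq.
apply: (irr_sorted_eq rtr rirr); first exact: pairwise_sorted.
  exact/pairwise_sorted/pairwise_filter.
by move=> x; rewrite mem_filter /=; case xs: (x \in s) => //=; rewrite st.
Qed.

End SortedSeq.

Lemma uniq_map_inj (T U : eqType) (f : T -> U) w :
  uniq (map f w) -> {in w &, injective f}.
Proof.
elim: w => //= a w IH /andP[aw uw] p q; rewrite !inE.
move=> /orP[/eqP->|pw] /orP[/eqP->|qw] fpq //; last exact: IH.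
- by rewrite fpq map_f in aw.
- by rewrite -fpq map_f in aw.
Qed.

Lemma ex_between (L M : seq rat) : (forall x z, x \in L -> z \in M -> x < z) ->
  exists r, (forall x, x \in L -> x < r) /\ (forall z, z \in M -> r < z).
Proof.
elim: M => [_|a M IH LM].
  elim: L => [|x L [r [Lr _]]]; first by exists 0.
  exists (Num.max x r + 1); split=> // y; rewrite inE => /orP[/eqP->|/Lr yr].
    by case: (leP x r) => ?; lra.
  by case: (leP x r) => ?; lra.
have [|r [Lr rM]] := IH; first by move=> x z xL zM; apply: LM; rewrite ?inE ?zM ?orbT.
have [|c [cm Lc]] := @ex_gap_below L (Num.min r a).
  by move=> x xL; rewrite lt_min Lr// LM ?mem_head.
move: cm; rewrite lt_min => /andP[cr ca].
exists ((c + Num.min r a) / 2); split=> [x /Lc xc|z]; first by case: (leP r a) => _; lra.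
rewrite inE => /orP[/eqP->|/rM rz]; first by case: (leP r a) => ?; lra.
by case: (leP r a) => ?; lra.
Qed.

Lemma card_seq_uniq (T : pointedType) (s : seq T) : uniq s ->
  ([set` s] #= `I_(size s))%card.
Proof.
move=> us; have -> : [set` s] = nth point s @` `I_(size s).
  apply/seteqP; split=> [x /= xs|_ [i /= si <-]]; last by rewrite /= mem_nth.
  by exists (index x s); rewrite /= ?index_mem ?nth_index.
apply: inj_card_eq => i j; rewrite !inE /= => si sj /eqP.
by rewrite nth_uniq// => /eqP.
Qed.

Lemma ex_notin (s : seq nat) : exists b, b \notin s.
Proof.
exists (\max_(i <- s) i).+1; apply/negP => bs.
by have := @leq_bigmax_seq _ s xpredT id _ bs isT; rewrite ltnn.
Qed.

Section IteratedUltrafilter.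
Variable U : set_system nat.
Hypothesis UU : UltraFilter U.

(** The n-th Fubini power of U, as an ultrafilter on the sequences of length n. *)
Fixpoint iter_ultra n : set_system (seq nat) :=
  if n is m.+1 then [set P | U [set x | iter_ultra m [set s | P (x :: s)]]]
  else [set P | P [::]].

Lemma iter_ultraS n P Q : P `<=` Q -> iter_ultra n P -> iter_ultra n Q.
Proof.
elim: n P Q => [|n IH] P Q PQ; first exact: PQ.
by move=> /=; apply: filterS => x; apply: IH => s; exact: PQ.
Qed.

Lemma iter_ultraI n P Q : iter_ultra n P -> iter_ultra n Q -> iter_ultra n (P `&` Q).
Proof.
elim: n P Q => [//|n IH] P Q /= nP nQ.
by apply: filterS (filterI nP nQ) => x [xP xQ]; exact: IH.
Qed.

Lemma iter_ultra_or n P Q : iter_ultra n [set s | P s \/ Q s] ->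
  iter_ultra n P \/ iter_ultra n Q.
Proof.
elim: n P Q => [//|n IH] P Q /= nPQ; apply: near_or.
by apply: filterS nPQ => x; exact: IH.
Qed.

Lemma iter_ultra_ex n P : iter_ultra n P -> exists s, P s.
Proof.
elim: n P => [|n IH] P /=; first by exists [::].
by move=> /filter_ex[x /IH[s Ps]]; exists (x :: s).
Qed.

Lemma iter_ultra_has n (I : eqType) (r : seq I) (P : I -> set (seq nat)) :
  iter_ultra n [set s | exists2 i, i \in r & P i s] ->
  exists2 i, i \in r & iter_ultra n (P i).
Proof.
elim: r => [/iter_ultra_ex[s []//]|i r IH rP].
have : iter_ultra n [set s | P i s \/ exists2 i, i \in r & P i s].
  apply: iter_ultraS rP => s [j]; rewrite inE => /orP[/eqP->|jr Ps]; first by left.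
  by right; exists j.
move=> /iter_ultra_or[|/IH[j jr]]; first by exists i; rewrite ?mem_head.
by exists j; rewrite // inE jr orbT.
Qed.

Definition delete i (s : seq nat) := take i s ++ drop i.+1 s.

Lemma iter_ultra_delete n i Q : (i <= n)%N -> iter_ultra n Q ->
  iter_ultra n.+1 [set s | Q (delete i s)].
Proof.
elim: i n Q => [|i IH] n Q ni nQ.
  by rewrite /=; apply: filterE => x; apply: iter_ultraS nQ => s; rewrite /delete /= ?drop0.
case: n ni nQ => // n ni /= nQ; apply: filterS nQ => x nQ.
exact: (IH n [set s | Q (x :: s)]).
Qed.

Hypothesis Uinfty : forall n, U [set m | (n < m)%N].

Lemma iter_ultra_notin n x : iter_ultra n [set s : seq nat | x \notin s].
Proof.
elim: n => //= n IH; apply: filterS (Uinfty x) => y /= xy.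
by apply: iter_ultraS IH => s /=; rewrite inE negb_or => ->; rewrite ltn_eqF.
Qed.

Lemma iter_ultra_uniq n : iter_ultra n [set s : seq nat | uniq s /\ size s = n].
Proof.
elim: n => //= n IH; apply: filterE => x.
apply: iter_ultraS (iter_ultraI IH (iter_ultra_notin n x)) => s [[us sn] /= xs].
by rewrite us xs sn.
Qed.

End IteratedUltrafilter.

Section GenericSequences.
Variable H : set SN.
Hypothesis H1 : H 1%g.
Hypothesis HM : forall g h, H g -> H h -> H (g * h)%g.
Hypothesis HV : forall g, H g -> H (g^-1)%g.
Hypothesis oligoH : oligomorphic H.
Hypothesis homH : highly_homogeneous H.

Lemma SN_VK (g : SN) : cancel g (g^-1%g : SN).
Proof. by move=> n; have := congr1 (fun h : SN => h n) (mulVg g). Qed.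

Lemma SN_inj (g : SN) : injective g.
Proof. exact: can_inj (SN_VK g). Qed.

Definition same_orbit (s t : seq nat) : Prop := exists2 h : SN, H h & map h s = t.

Lemma same_orbit_refl s : same_orbit s s.
Proof. by exists 1%g => //; rewrite -[RHS]map_id; apply: eq_map. Qed.

Lemma same_orbit_sym s t : same_orbit s t -> same_orbit t s.
Proof. by move=> [h Hh <-]; exists (h^-1)%g; [exact: HV|rewrite mapK//; exact: SN_VK]. Qed.

Lemma same_orbit_trans s t u : same_orbit s t -> same_orbit t u -> same_orbit s u.
Proof.
move=> [h Hh <-] [k Kk <-]; exists (k * h)%g; first exact: HM.
by rewrite -map_comp; apply: eq_map.
Qed.

Variable U : set_system nat.
Hypothesis UU : UltraFilter U.
Hypothesis Uinfty : forall n, U [set m | (n < m)%N].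

(** Finitely many orbits cover the sequences of length n, so an ultrafilter
    concentrates on one of them. *)
Lemma ex_generic_orbit n : exists t : seq nat, iter_ultra U n (same_orbit t).
Proof.
case: n => [|n]; first by exists [::]; exact: same_orbit_refl.
have /finite_seqP[r rE] := oligoH (ltn0Sn n).
have [|O Or nO] := @iter_ultra_has U UU n.+1 _ r
  (fun O => [set s | exists2 t, O t & tval t = s]).
  apply: iter_ultraS (iter_ultra_uniq UU Uinfty n.+1) => s /= [_ sn].
  pose t : n.+1.-tuple nat := tcast sn (in_tuple s).
  have tE : tval t = s by rewrite val_tcast.
  exists [set map_tuple (g : SN) t | g in H].
    by have : [set` r] [set map_tuple (g : SN) t | g in H] by rewrite -rE; exists t.
  exists t => //; exists 1%g => //; apply: val_inj => /=.
  by rewrite -[RHS]map_id; apply: eq_map.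
have : [set` r] O by [].
rewrite -rE => -[t _ OE]; exists (tval t); apply: iter_ultraS nO => s [u].
by rewrite -OE => -[h Hh <-] <-; exists h.
Qed.

Definition generic_rep n : seq nat := sval (cid (ex_generic_orbit n)).

Lemma generic_repP n : iter_ultra U n (same_orbit (generic_rep n)).
Proof. exact: (svalP (cid (ex_generic_orbit n))). Qed.

Lemma generic_rep_uniq n : uniq (generic_rep n) /\ size (generic_rep n) = n.
Proof.
have [s [[us sn] [h _ hs]]] := iter_ultra_ex UU (iter_ultraI UU
  (iter_ultra_uniq UU Uinfty n) (generic_repP n)).
by split; [move: us; rewrite -hs => /map_uniq|rewrite -[RHS]sn -hs size_map].
Qed.

(** The orbit on which the Fubini power of U with exponent size s concentrates. *)
Definition generic s := same_orbit (generic_rep (size s)) s.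

Lemma generic_uniq s : generic s -> uniq s.
Proof.
by move=> [h _ <-]; rewrite map_inj_uniq; [case: (generic_rep_uniq (size s))|exact: SN_inj].
Qed.

Lemma generic_same_orbit s t : generic s -> generic t -> size s = size t -> same_orbit s t.
Proof.
by rewrite /generic => gs gt st; apply: same_orbit_trans (same_orbit_sym gs) _; rewrite st.
Qed.

Lemma generic_map (h : SN) s : H h -> generic (map h s) -> generic s.
Proof.
rewrite /generic size_map => Hh gs; apply: same_orbit_trans gs _.
by apply: same_orbit_sym; exists h.
Qed.

Lemma generic_image (h : SN) s : H h -> generic s -> generic (map h s).
Proof.
by rewrite /generic size_map => Hh gs; apply: same_orbit_trans gs _; exists h.
Qed.

Lemma generic_nil : generic [::].
Proof.
by rewrite /generic; have [_ /size0nil->] := generic_rep_uniq 0; exact: same_orbit_refl.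
Qed.

(** Deleting an entry maps almost all sequences of length n + 1 to almost all
    sequences of length n, and a single orbit is involved at each length. *)
Lemma generic_delete A x B : generic (A ++ x :: B) -> generic (A ++ B).
Proof.
move=> gAB; set n := size (A ++ B).
have An : (size A <= n)%N by rewrite /n size_cat leq_addr.
have sn : size (A ++ x :: B) = n.+1 by rewrite /n !size_cat addnS.
have [s [st sd]] := iter_ultra_ex UU (iter_ultraI UU (generic_repP n.+1)
  (iter_ultra_delete UU An (generic_repP n))).
move: gAB; rewrite /generic sn -/n => gAB.
have [h Hh sAB] := same_orbit_trans (same_orbit_sym st) gAB.
apply: (same_orbit_trans sd); exists h => //.
rewrite /delete map_cat map_take map_drop sAB take_size_cat// -cat_rcons drop_size_cat//.
by rewrite size_rcons.
Qed.

Lemma generic_subseq s t : subseq s t -> generic t -> generic s.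
Proof.
suff sub A : subseq s t -> generic (A ++ t) -> generic (A ++ s) by exact: (sub [::]).
elim: t s A => [|x t IH] s A; first by rewrite subseq0 => /eqP->.
case: s => [_ /generic_delete|y s]; first by apply: IH; exact: sub0seq.
rewrite [subseq _ _]/=; case: eqP => [->|_] sub.
  by rewrite -!cat_rcons; exact: IH.
by move=> /generic_delete; exact: IH.
Qed.

Lemma ex_generic_insertion A B : generic (A ++ B) -> exists b, generic (A ++ b :: B).
Proof.
move=> gAB; set n := size (A ++ B); set t := generic_rep n.+1.
have [ut st] := generic_rep_uniq n.+1.
have gt : generic t by rewrite /generic /t st; exact: same_orbit_refl.
have tE : t = take (size A) t ++ nth 0%N t (size A) :: drop (size A).+1 t.
  by rewrite -drop_nth ?cat_take_drop// /t st ltnS /n size_cat leq_addr.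
move: gt; rewrite tE; set A' := take _ _; set B' := drop _ _; set b := nth _ _ _ => gt.
have sA : size A' = size A by rewrite size_takel// /t st /n size_cat -addnS leq_addr.
have sB : size B' = size B by rewrite size_drop /t st /n size_cat subSS addnC addnK.
have [|h Hh] := generic_same_orbit (generic_delete gt) gAB.
  by rewrite !size_cat sA sB.
rewrite map_cat => /eqP; rewrite eqseq_cat ?size_map// => /andP[/eqP hA /eqP hB].
by exists (h b); rewrite -hA -hB -map_cons -map_cat; exact: generic_image.
Qed.

Lemma ex_generic_enum m : exists e, [/\ generic e, uniq e & e =i iota 0 m].
Proof.
have [ut st] := generic_rep_uniq m; set t := generic_rep m in ut st.
have ti : ([set` t] #= [set` iota 0 m])%card.
  apply: card_eq_trans (card_seq_uniq ut) _; rewrite card_eq_sym.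
  by have := card_seq_uniq (iota_uniq 0 m); rewrite size_iota st.
have [g Hg gt] := homH (finite_seq t) (finite_seq (iota 0 m)) ti.
exists (map g t); split.
- by apply: generic_image => //; rewrite /generic st; exact: same_orbit_refl.
- by rewrite map_inj_uniq//; exact: SN_inj.
- move=> x; apply/idP/idP => [/mapP[y yt ->]|xi].
    by have : [set` iota 0 m] (g y) by rewrite -gt; exists y.
  by have : (g @` [set` t]) x by [rewrite gt]; move=> [y yt <-]; exact: map_f.
Qed.

Definition generic_enum m : seq nat := sval (cid (ex_generic_enum m)).

Lemma generic_enumP m :
  [/\ generic (generic_enum m), uniq (generic_enum m) & generic_enum m =i iota 0 m].
Proof. exact: (svalP (cid (ex_generic_enum m))). Qed.

(** The limit along U, as m grows, of the orders in which the generic enumerations list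
    the first m integers. *)
Definition limit_lt : rel nat := fun x y =>
  `[< U [set m | (index x (generic_enum m) < index y (generic_enum m))%N] >].

Lemma limit_lt_trans : transitive limit_lt.
Proof.
move=> y x z /asboolP xy /asboolP yz; apply/asboolP.
by apply: filterS (filterI xy yz) => m [/= /ltn_trans]; exact.
Qed.

Lemma near_mem_enum x : U [set m | x \in generic_enum m].
Proof.
by apply: filterS (Uinfty x) => m /= xm; have [_ _ ->] := generic_enumP m; rewrite mem_iota.
Qed.

Lemma limit_lt_total x y : x != y -> limit_lt x y \/ limit_lt y x.
Proof.
move=> xy; suff /near_or[?|?] : U [set m |
    (index x (generic_enum m) < index y (generic_enum m))%N \/
    (index y (generic_enum m) < index x (generic_enum m))%N].
- by left; apply/asboolP.
- by right; apply/asboolP.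
apply: filterS (filterI (near_mem_enum x) (near_mem_enum y)) => m [/= xm ym].
case: (ssrnat.ltngtP (index x (generic_enum m)) (index y _)) => [?|?|e].
- by left.
- by right.
by move: xy; rewrite -(nth_index 0%N xm) e nth_index// eqxx.
Qed.

(** A sequence that is increasing for the limit order is, for almost all m, a
    subsequence of the generic enumeration of the first m integers. *)
Lemma generic_of_limit_lt s : pairwise limit_lt s -> generic s.
Proof.
move=> ps; have : U [set m | pairwise (fun x y => (index x (generic_enum m) <
    index y (generic_enum m))%N) s].
  elim: s ps => [_|x s IH /= /andP[/allP xs /IH nps]]; first exact: filterE.
  have nx : U [set m | forall y, y \in s ->
      (index x (generic_enum m) < index y (generic_enum m))%N].
    by apply: near_in => y /xs/asboolW.
  apply: filterS (filterI nx nps) => m [/= sx ->]; rewrite andbT.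
  by apply/allP => y /sx.
have nm : U [set m | forall x, x \in s -> x \in generic_enum m].
  by apply: near_in => x _; exact: near_mem_enum.
move=> /filterI/(_ nm)/filter_ex[m [psm sm]].
have [ge ue _] := generic_enumP m; apply: generic_subseq ge.
pose r : rel nat := fun x y => (index x (generic_enum m) < index y (generic_enum m))%N.
apply: (@sorted_subseq_of_mem _ r) => //.
- by move=> y x z; exact: ltn_trans.
- by move=> x; rewrite /r ltnn.
- apply/(pairwiseP 0%N) => i j; rewrite !inE => im jm ij.
  by rewrite /r !index_uniq.
Qed.

Lemma ex_limit_lt_seq n : exists s, size s = n /\ pairwise limit_lt s.
Proof.
elim: n => [|n [s [sn ps]]]; first by exists [::].
have [b bs] := ex_notin s.
have [x xs|//|L [M [sLM pLM]]] := @ex_insertion _ limit_lt s b limit_lt_trans.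
  by apply: limit_lt_total; apply: contra bs => /eqP<-.
by exists (L ++ b :: M); split=> //; rewrite -sn sLM !size_cat addnS.
Qed.

(** The group moves s onto an increasing sequence for the limit order, where the
    position of the new entry can be read off. *)
Lemma ex_generic_position s b : generic s -> b \notin s ->
  exists A B, s = A ++ B /\ generic (A ++ b :: B).
Proof.
move=> gs bs; have [e [es pe]] := ex_limit_lt_seq (size s).
have [h Hh se] := generic_same_orbit gs (generic_of_limit_lt pe) (esym es).
have hb : h b \notin e by rewrite -se mem_map//; exact: SN_inj.
have [x xs|//|L [M [eLM /generic_of_limit_lt gLM]]] := 
  @ex_insertion _ limit_lt e (h b) limit_lt_trans.
  by apply: limit_lt_total; apply: contra hb => /eqP<-.
exists (take (size L) s), (drop (size L) s); split; first by rewrite cat_take_drop.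
apply: (generic_map Hh); rewrite map_cat /= map_take map_drop se eLM.
by rewrite take_size_cat// drop_size_cat.
Qed.

(** The finite stages of the back-and-forth construction. *)
Definition matching (w : seq (rat * nat)) : Prop :=
  pairwise ratlt (unzip1 w) /\ generic (unzip2 w).

Lemma unzip_split (w : seq (rat * nat)) k r n :
  let w' := take k w ++ (r, n) :: drop k w in
  [/\ {subset w <= w'}, (r, n) \in w',
     unzip1 w' = take k (unzip1 w) ++ r :: drop k (unzip1 w)
   & unzip2 w' = take k (unzip2 w) ++ n :: drop k (unzip2 w)].
Proof.
split.
- by move=> p; rewrite -{1}(cat_take_drop k w) !mem_cat inE => /orP[->|->]; rewrite ?orbT.
- by rewrite mem_cat mem_head orbT.
- by rewrite /unzip1 map_cat /= map_take map_drop.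
- by rewrite /unzip2 map_cat /= map_take map_drop.
Qed.

Lemma matching_forth w r : matching w ->
  exists w', [/\ matching w', {subset w <= w'} & r \in unzip1 w'].
Proof.
move=> mw; have [rw|rw] := boolP (r \in unzip1 w); first by exists w; split.
have [pw gw] := mw.
have [x xw|//|L [M [wLM pLM]]] := @ex_insertion _ ratlt (unzip1 w) r ratlt_trans.
  have : x != r by apply: contra rw => /eqP<-.
  by rewrite neq_lt => /orP[]; [left|right].
have gw' : generic (take (size L) (unzip2 w) ++ drop (size L) (unzip2 w)).
  by rewrite cat_take_drop.
have [n gn] := ex_generic_insertion gw'.
have [sub rn w1 w2] := unzip_split w (size L) r n.
exists (take (size L) w ++ (r, n) :: drop (size L) w); split=> //.
  split; last by rewrite w2.
  by rewrite w1 wLM take_size_cat// drop_size_cat.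
by apply/mapP; exists (r, n).
Qed.

Lemma matching_back w n : matching w ->
  exists w', [/\ matching w', {subset w <= w'} & n \in unzip2 w'].
Proof.
move=> mw; have [nw|nw] := boolP (n \in unzip2 w); first by exists w; split.
have [pw gw] := mw.
have [A [B [wAB gAB]]] := ex_generic_position gw nw.
have := pw; rewrite -{1}(cat_take_drop (size A) (unzip1 w)) pairwise_cat.
move=> /and3P[/allrelP LM pL pM].
have [r [Lr rM]] := ex_between LM.
have [sub rn w1 w2] := unzip_split w (size A) r n.
exists (take (size A) w ++ (r, n) :: drop (size A) w); split=> //.
  split; last by rewrite w2 wAB take_size_cat// drop_size_cat.
  rewrite w1 pairwise_cat /= pL pM !andbT; apply/andP; split; last by apply/allP => z /rM.
  apply/allrelP => x z xL; rewrite inE => /orP[/eqP->|]; first exact: Lr.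
  exact: LM.
by apply/mapP; exists (r, n).
Qed.

Lemma ex_matching_chain : exists W : nat -> seq (rat * nat),
  [/\ forall k, matching (W k), forall k l, (k <= l)%N -> {subset W k <= W l},
     forall n, exists k, n \in unzip2 (W k)
   & forall r, exists k, r \in unzip1 (W k)].
Proof.
have /choice[next nextP] (wk : seq (rat * nat) * nat) : exists w', matching wk.1 ->
    [/\ matching w', {subset wk.1 <= w'}, wk.2 \in unzip2 w' &
        forall r : rat, choice.unpickle wk.2 = Some r -> r \in unzip1 w'].
  have [mw|] := pselect (matching wk.1); last by exists [::].
  have [w1 [mw1 sub1 n1]] := matching_back wk.2 mw.
  have [w2 [mw2 sub2 r2]] := matching_forth (odflt 0 (choice.unpickle wk.2)) mw1.
  exists w2 => _; split=> //.
  - by move=> p /sub1/sub2.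
  - by move: n1 => /mapP[p /sub2 pw ->]; exact: map_f.
  - by move=> r rE; rewrite rE in r2.
pose W := fix W k := if k is l.+1 then next (W l, l) else [::].
have mW k : matching (W k).
  elim: k => [|k IH] /=; first by split=> //; exact: generic_nil.
  by have [] := nextP (W k, k) IH.
have WS k : [/\ {subset W k <= W k.+1}, k \in unzip2 (W k.+1) &
    forall r : rat, choice.unpickle k = Some r -> r \in unzip1 (W k.+1)].
  by have [] := nextP (W k, k) (mW k).
exists W; split=> //.
- move=> k l /subnK <-; elim: (l - k)%N => [//|i IH] p pk.
  by have [sub _ _] := WS (i + k)%N; apply: sub; exact: IH.
- by move=> n; exists n.+1; have [] := WS n.
- move=> r; exists (choice.pickle r).+1; have [_ _] := WS (choice.pickle r).
  by apply; exact: choice.pickleK.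
Qed.

Lemma ex_generic_numbering : exists (phi : rat -> nat) (psi : nat -> rat),
  [/\ cancel phi psi, cancel psi phi &
     forall s, sorted ratlt s -> generic (map phi s)].
Proof.
have [W [mW Wmono Wback Wforth]] := ex_matching_chain.
have u1 k : uniq (unzip1 (W k)).
  by have [p _] := mW k; exact: pairwise_uniq ratlt_irr p.
have u2 k : uniq (unzip2 (W k)) by have [_ /generic_uniq] := mW k.
have Wcommon p q k l : p \in W k -> q \in W l -> p \in W (maxn k l) /\ q \in W (maxn k l).
  move=> pk ql; split; first by apply: Wmono pk; exact: leq_maxl.
  by apply: Wmono ql; exact: leq_maxr.
have /choice[phi phiP] (r : rat) : exists n, exists k, (r, n) \in W k.
  by have [k /mapP[[r' n] rn /= ->]] := Wforth r; exists n, k.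
have /choice[psi psiP] (n : nat) : exists r, exists k, (r, n) \in W k.
  by have [k /mapP[[r n'] rn /= ->]] := Wback n; exists r, k.
have phiE r n k : (r, n) \in W k -> phi r = n.
  move=> rn; have [l rl] := phiP r; have [rn' rl'] := Wcommon _ _ _ _ rn rl.
  by have [] := uniq_map_inj (u1 _) rl' rn' erefl.
exists phi, psi; split.
- move=> r; have [k rk] := phiP r; have [l sl] := psiP (phi r).
  have [rk' sl'] := Wcommon _ _ _ _ rk sl.
  by have [] := uniq_map_inj (u2 _) sl' rk' erefl.
- by move=> n; have [k] := psiP n; exact: phiE.
move=> s ss; have [k sk] : exists k, {subset s <= unzip1 (W k)}.
  elim: s {ss} => [|r s [k sk]]; first by exists 0%N.
  have [l rl] := phiP r; exists (maxn k l) => q; rewrite inE => /orP[/eqP->|].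
    by apply/mapP; exists (r, phi r) => //; apply: Wmono rl; exact: leq_maxr.
  move=> /sk/mapP[p pk ->]; apply: map_f; apply: Wmono pk; exact: leq_maxl.
have [p g] := mW k; apply: generic_subseq g.
have -> : unzip2 (W k) = map phi (unzip1 (W k)).
  by rewrite -map_comp; apply/eq_in_map => -[r n] /phiE.
apply/map_subseq/(sorted_subseq_of_mem ratlt_trans ratlt_irr _ p) => //.
by rewrite -sorted_pairwise//; exact: ratlt_trans.
Qed.

(** An increasing bijection of the rationals agrees on each finite set with an
    element of H, as it maps increasing sequences to increasing sequences. *)
Lemma ex_rational_order :
    (forall g : SN, (forall F : seq nat, exists2 h : SN, H h & {in F, h =1 g}) -> H g) ->
  exists (phi : rat -> nat) (psi : nat -> rat), [/\ cancel phi psi, cancel psi phi &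
    forall f (g : SN), increasing_bijection f -> g =1 phi \o f \o psi -> H g].
Proof.
move=> closedH; have [phi [psi [phiK psiK gphi]]] := ex_generic_numbering.
exists phi, psi; split=> // f g [bf hf] gE; apply: closedH => F.
pose s := sort <=%R (undup (map psi F)).
have ss : sorted ratlt s by rewrite /ratlt sort_lt_sorted undup_uniq.
have fss : sorted ratlt (map f s).
  by rewrite sorted_map; apply: sub_sorted ss => x y; exact: hf.
have [|h Hh hs] := generic_same_orbit (gphi _ ss) (gphi _ fss); first by rewrite !size_map.
exists h => // n nF; rewrite gE /=.
have : psi n \in s by rewrite mem_sort mem_undup map_f.
move: hs; rewrite -!map_comp => /eq_in_map/[apply] /=.
by rewrite psiK.
Qed.

End GenericSequences.

(** * Hausdorff group topologies *)

Section GroupTopology.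
Variables (G : groupType) (sigma : Topological G).
Let X : topologicalType := Topological.Pack sigma.
Hypothesis hG : hausdorff_group_topology sigma.

Lemma continuous_mul (Y : topologicalType) (u v : Y -> X) (y : Y) :
  {for y, continuous u} -> {for y, continuous v} ->
  {for y, continuous (fun z => (u z : G) * (v z : G) : X)%g}.
Proof.
move=> cu cv; have [[cM _] _] := hG.
apply: (@continuous_comp _ _ _ (fun z => (u z, v z))
  (fun p : X * X => (p.1 : G) * (p.2 : G) : X)%g).
  exact: cvg_pair.
exact: cM.
Qed.

Lemma continuous_inv (Y : topologicalType) (u : Y -> X) (y : Y) :
  {for y, continuous u} -> {for y, continuous (fun z => (u z : G)^-1 : X)%g}.
Proof.
move=> cu; have [[_ cV] _] := hG.
by apply: (@continuous_comp _ _ _ u (fun x : X => (x : G)^-1 : X)%g) => //; exact: cV.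
Qed.

Lemma near_neq (Y : topologicalType) (u v : Y -> X) (y : Y) :
  {for y, continuous u} -> {for y, continuous v} -> u y <> v y ->
  nbhs y [set z | u z <> v z].
Proof.
move=> cu cv uv; have [_ hX] := hG.
have [A [B [uA vB AB]]] : exists A B, [/\ nbhs (u y) A, nbhs (v y) B & A `&` B = set0].
  apply: contrapT => nAB; apply: uv; apply: hX => A B nA nB; apply: contrapT => AB.
  apply: nAB; exists A, B; split=> //; apply: contrapT => /eqP/set0P; exact: AB.
have nA : nbhs y (u @^-1` A) by exact: cu.
have nB : nbhs y (v @^-1` B) by exact: cv.
apply: filterS (filterI nA nB) => z [/= Az Bz] uvz.
have : (A `&` B) (u z) by split=> //; rewrite uvz.
by rewrite AB.
Qed.

Section Action.
Variables (T : Type) (act : G -> T -> T).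
Hypothesis actM : forall x y t, act (x * y)%g t = act x (act y t).
Hypothesis act1 : forall t, act 1%g t = t.
Hypothesis act_faithful : forall x y, act x =1 act y -> x = y.

Lemma act_inj x : injective (act x).
Proof.
by apply: (@can_inj _ _ _ (act x^-1%g)) => t; rewrite -actM mulVg.
Qed.

(** For y near x the conjugate of f by y x^-1 is close to f, so it does not commute
    with f'; but permutations with disjoint supports commute. *)
Lemma near_meets_support (x f f' : G) : (f * f')%g <> (f' * f)%g ->
  nbhs (x : X) [set y : X | exists t, act f t <> t /\
    act f' (act ((y : G) * x^-1)%g t) <> act ((y : G) * x^-1)%g t].
Proof.
move=> ff'; pose g (y : X) : X := ((y : G) * x^-1)%g.
have cst (k : G) : {for (x : X), continuous (fun _ : X => k : X)} by exact: cvg_cst.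
have cg : {for (x : X), continuous g} by apply: continuous_mul; [exact: cvg_id|exact: cst].
pose c (y : X) : X := ((g y : G) * f * (g y : G)^-1)%g.
have cc : {for (x : X), continuous c}.
  by apply: continuous_mul; [apply: continuous_mul|exact: continuous_inv].
have c1 : c x = f by rewrite /c /g mulgV invg1 mulg1 mul1g.
have : nbhs (x : X) [set y : X | ((c y : G) * f')%g <> (f' * (c y : G))%g].
  apply: (@near_neq _ (fun y => (c y : G) * f' : X)%g (fun y => f' * (c y : G) : X)%g).
  - exact: continuous_mul.
  - exact: continuous_mul.
  - by rewrite c1.
apply: filterS => y nc; apply: contrapT => disj; apply: nc.
have gK t : act (g y) (act (g y : G)^-1%g t) = t by rewrite -actM mulgV act1.
have cE t : act (c y) t = act (g y) (act f (act (g y : G)^-1%g t)) by rewrite !actM.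
have fixed t : act (c y) t <> t -> act f' t = t.
  move=> ct; apply: contrapT => f't; apply: disj; exists (act (g y : G)^-1%g t).
  by rewrite -/(g y) gK; split=> // ft; apply: ct; rewrite cE ft gK.
apply: act_faithful => t; rewrite (actM (c y) f') (actM f' (c y)).
have [f't|f't] := pselect (act f' t = t).
  rewrite f't; have [ct|ct] := pselect (act (c y) t = t); first by rewrite ct f't.
  by rewrite fixed// => /act_inj.
have cf s : act f' s <> s -> act (c y) s = s.
  by move=> f's; apply: contrapT => /fixed.
by rewrite !cf// => /act_inj.
Qed.

End Action.
End GroupTopology.

(** * Pointwise convergence for the order topology of the rationals *)

Definition box (I : Type) (ev : I -> rat -> rat) (L : seq (rat * (rat * rat))) : set I :=
  [set x | forall p a b, (p, (a, b)) \in L -> a < ev x p /\ ev x p < b].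

(** An alias of G that carries the topology of pointwise convergence, for the order
    topology of the rationals. *)
Definition order_pointwise (G : choiceType) (act : G -> rat -> rat) : Type := G.

Section OrderPointwise.
Variables (G : choiceType) (act : G -> rat -> rat).
Notation T := (order_pointwise act).

HB.instance Definition _ := Choice.on T.

Definition order_open : set_system T :=
  [set U | forall x, U x -> exists L, box act L x /\ box act L `<=` U].

Lemma order_openT : order_open setT.
Proof. by move=> x _; exists [::]; split. Qed.

Lemma order_openI : setI_closed order_open.
Proof.
move=> A B oA oB x [/oA[L [Lx LA]] /oB[M [Mx MB]]]; exists (L ++ M); split.
  by move=> p a b; rewrite mem_cat => /orP[/Lx|/Mx].
move=> y LMy; split; [apply: LA|apply: MB] => p a b pab; apply: LMy;
  by rewrite mem_cat pab ?orbT.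
Qed.

Lemma order_open_bigU (I : Type) (f : I -> set T) :
  (forall i, order_open (f i)) -> order_open (\bigcup_i f i).
Proof.
move=> fo x [i _ /fo[L [Lx Lf]]]; exists L; split=> // y /Lf fy; by exists i.
Qed.

HB.instance Definition _ :=
  isOpenTopological.Build T order_openT order_openI order_open_bigU.

Lemma nbhs_order_pointwise (x : T) (U : set T) :
  nbhs x U <-> exists L, box act L x /\ box act L `<=` U.
Proof.
split.
  move=> [B [oB Bx BU]]; have [L [Lx LB]] := oB x Bx.
  by exists L; split=> // y /LB/BU.
move=> [L [Lx LU]]; exists (box act L : set T); split=> //.
by move=> y Ly; exists L; split=> // z.
Qed.

Lemma order_pointwise_cvg (F : set_system T) (x : T) : Filter F ->
    (forall p a b, a < act x p -> act x p < b -> F [set y | a < act y p /\ act y p < b]) ->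
  F --> x.
Proof.
move=> FF Fx U /nbhs_order_pointwise[L [Lx LU]]; apply: filterS LU _.
elim: L Lx => [_|[p [a b]] L IH Lx]; first by apply: filterE => y q.
have [ap pb] := Lx p a b (mem_head _ _).
have FL : F (box act L) by apply: IH => q c d qL; apply: Lx; rewrite inE qL orbT.
apply: filterS (filterI (Fx p a b ap pb) FL) => y [/= apb Ly] q c d.
by rewrite inE => /orP[/eqP[-> -> ->]|/Ly].
Qed.

(** Continuity of u at x for the order topology of the rationals, tested on rays. *)
Definition order_continuous (u : T -> rat) (x : T) : Prop :=
  forall c, (u x < c -> nbhs x [set y | u y < c]) /\ (c < u x -> nbhs x [set y | c < u y]).

Lemma order_continuous_act p (x : T) : order_continuous (act^~ p) x.
Proof.
move=> c; split=> xc; apply/nbhs_order_pointwise.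
  exists [:: (p, (act x p - 1, c))]; split=> [q a b|y].
    by rewrite inE => /eqP[-> -> ->]; split=> //; lra.
  by move=> h; have [] := h p (act x p - 1) c (mem_head _ _).
exists [:: (p, (c, act x p + 1))]; split=> [q a b|y].
  by rewrite inE => /eqP[-> -> ->]; split=> //; lra.
by move=> h; have [] := h p c (act x p + 1) (mem_head _ _).
Qed.

Lemma order_continuous_cst c (x : T) : order_continuous (fun=> c) x.
Proof. by move=> d; split=> cd; apply: filterE. Qed.

Lemma near_lt (u v : T -> rat) x : order_continuous u x -> order_continuous v x ->
  u x < v x -> nbhs x [set y | u y < v y].
Proof.
move=> cu cv uv; have um : u x < (u x + v x) / 2 by lra.
have mv : (u x + v x) / 2 < v x by lra.
have [/(_ um) nu _] := cu ((u x + v x) / 2); have [_ /(_ mv) nv] := cv ((u x + v x) / 2).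
by apply: filterS (filterI nu nv) => y [/= ]; exact: lt_trans.
Qed.

Lemma near_cyc (u v w : T -> rat) x : order_continuous u x -> order_continuous v x ->
  order_continuous w x -> cyc (u x) (v x) (w x) -> nbhs x [set y | cyc (u y) (v y) (w y)].
Proof.
move=> cu cv cw; rewrite /cyc => /or3P[]/andP[h1 h2].
- apply: filterS (filterI (near_lt cu cv h1) (near_lt cv cw h2)) => y [/= k1 k2].
  by rewrite k1 k2.
- apply: filterS (filterI (near_lt cv cw h1) (near_lt cw cu h2)) => y [/= k1 k2].
  by rewrite k1 k2 /= ?orbT.
- apply: filterS (filterI (near_lt cw cu h1) (near_lt cu cv h2)) => y [/= k1 k2].
  by rewrite k1 k2 /= ?andbT ?orbT.
Qed.

Lemma near_sep (u v w z : T -> rat) x : order_continuous u x -> order_continuous v x ->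
    order_continuous w x -> order_continuous z x -> sep (u x) (v x) (w x) (z x) ->
  nbhs x [set y | sep (u y) (v y) (w y) (z y)].
Proof.
move=> cu cv cw cz; rewrite /sep => /orP[]/andP[h1 h2].
- apply: filterS (filterI (near_cyc cu cw cv h1) (near_cyc cv cz cu h2)) => y [/= k1 k2].
  by rewrite k1 k2.
- apply: filterS (filterI (near_cyc cu cz cv h1) (near_cyc cv cw cu h2)) => y [/= k1 k2].
  by rewrite k1 k2 /= ?orbT.
Qed.

End OrderPointwise.

Lemma sep_out_in k1 k2 q r : k1 < q -> q < k2 -> r < k1 \/ k2 < r -> sep k1 k2 q r.
Proof.
move=> k1q qk2 rk; have k12 := lt_trans k1q qk2; rewrite /sep /cyc k1q qk2 /=.
by case: rk => h; rewrite h k12 /= ?orbT.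
Qed.

Lemma sep_inside a b u v w z : a < u -> u < b -> a < v -> v < b -> z <= a \/ b <= z ->
  sep u v w z -> a < w /\ w < b.
Proof.
move=> au ub av vb abz.
by rewrite /sep /cyc => /orP[]/andP[]/or3P[]/andP[? ?] /or3P[]/andP[? ?];
  case: abz => ?; split; lra.
Qed.

Lemma ex_isolating (s : seq rat) q : exists k1 k2, [/\ k1 < q, q < k2 &
  forall z, z \in s -> [\/ z = q, z < k1 | k2 < z]].
Proof.
have [|k1 [sk1 k1q]] := @ex_between [seq z <- s | z < q] [:: q].
  by move=> x z; rewrite mem_filter inE => /andP[xq _] /eqP->.
have [|k2 [qk2 k2s]] := @ex_between [:: q] [seq z <- s | q < z].
  by move=> x z; rewrite mem_filter inE => /eqP-> /andP[].
exists k1, k2; split; [exact: k1q (mem_head _ _)|exact: qk2 (mem_head _ _)|].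
move=> z zs; case: (ltgtP z q) => zq; last exact: Or31.
- by apply: Or32; apply: sk1; rewrite mem_filter zq.
- by apply: Or33; apply: k2s; rewrite mem_filter zq.
Qed.

Lemma cyc_neq x y z : cyc x y z -> x != y /\ y != z.
Proof. by rewrite /cyc => /or3P[]/andP[? ?]; split; apply/eqP => ?; lra. Qed.

Lemma cyc_asym x y z : cyc x y z -> cyc z y x -> False.
Proof. by rewrite /cyc => /or3P[]/andP[? ?] /or3P[]/andP[? ?]; lra. Qed.

Lemma sep_neq a b q c : sep a b q c -> [/\ a != q, b != q & c != q].
Proof.
rewrite /sep => /orP[]/andP[h h'].
- have [? qb] := cyc_neq h; rewrite eq_sym in qb; split=> //.
  by apply/eqP => e; rewrite e in h'; exact: cyc_asym h h'.
- have [? qb] := cyc_neq h'; rewrite eq_sym in qb; split=> //.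
  by apply/eqP => e; rewrite e in h; exact: cyc_asym h h'.
Qed.

(** The arcs of the circle are open. *)
Lemma sep_open a b q c : sep a b q c -> exists k1 k2,
  [/\ k1 < q, q < k2, c < k1 \/ k2 < c, sep a b k1 c & sep a b k2 c].
Proof.
move=> sq; have [aq bq cq] := sep_neq sq.
have [k1 [k2 [k1q qk2 iso]]] := ex_isolating [:: a; b; c] q.
have {}iso z : z \in [:: a; b; c] -> z != q -> z < k1 \/ k2 < z.
  by move=> /iso[->|?|?]; rewrite ?eqxx//; [left|right].
have ia : a < k1 \/ k2 < a by apply: iso; rewrite ?inE ?eqxx.
have ib : b < k1 \/ k2 < b by apply: iso; rewrite ?inE ?eqxx ?orbT.
have ic : c < k1 \/ k2 < c by apply: iso; rewrite ?inE ?eqxx ?orbT.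
have same z k : z < k1 \/ k2 < z -> k1 <= k -> k <= k2 ->
    (z < k) = (z < q) /\ (k < z) = (q < z).
  by move=> h k1k kk2; case: (ltP z k); case: (ltP z q); case: (ltP k z); case: (ltP q z);
    split=> //; case: h => ?; lra.
(* No point of a, b lies between k1 and k2, where sep a b - c is thus constant. *)
have sepE k : k1 <= k -> k <= k2 -> sep a b k c = sep a b q c.
  move=> k1k kk2; have [a1 a2] := same a k ia k1k kk2.
  by have [b1 b2] := same b k ib k1k kk2; rewrite /sep /cyc a1 a2 b1 b2.
have k12 := ltW (lt_trans k1q qk2).
by exists k1, k2; rewrite !sepE ?lexx//; split.
Qed.

Section OrderGroupTopology.
Variables (G : groupType) (act : G -> rat -> rat).
Hypothesis actM : forall x y t, act (x * y)%g t = act x (act y t).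
Hypothesis act1 : forall t, act 1%g t = t.
Hypothesis act_faithful : forall x y, act x =1 act y -> x = y.
Hypothesis act_sep : forall x a b c d,
  sep a b c d -> sep (act x a) (act x b) (act x c) (act x d).

Notation T := (order_pointwise act).

Definition order_topology : Topological G := Topological.class T.

Lemma actK (x : G) : cancel (act x) (act x^-1%g).
Proof. by move=> t; rewrite -actM mulVg act1. Qed.

Lemma actVK (x : G) : cancel (act x^-1%g) (act x).
Proof. by move=> t; rewrite -actM mulgV act1. Qed.

Lemma near_box (x : T) p a b : a < act x p -> act x p < b ->
  nbhs x [set y : T | a < act y p /\ act y p < b].
Proof.
move=> ap pb; have [/(_ pb) nb _] := order_continuous_act p x b.
have [_ /(_ ap) na] := order_continuous_act p x a.
exact: filterS (filterI na nb).
Qed.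

(** The preimage by x of the interval from a to b is an arc around q, hence contains
    an interval from k1 to k2 around q, and c = x^-1 (b + 1) lies outside. For x' near
    x the points x' k1 and x' k2 stay between a and b and x' c stays outside, so x'
    maps the points between k1 and k2 into the interval from a to b. *)
Lemma order_mul_continuous :
  continuous (fun z : T * T => (z.1 : G) * (z.2 : G) : T)%g.
Proof.
move=> [x y]; apply: order_pointwise_cvg => p a b.
rewrite actM; set q := act y p => aq qb.
pose c := act x^-1%g (b + 1).
have ab : a < b by exact: lt_trans qb.
have : sep a b (act x q) (b + 1) by apply: sep_out_in => //; right; lra.
move=> /(act_sep x^-1%g); rewrite actK -/c => /sep_open[k1 [k2 [k1q qk2 ck]]].
have inx k : sep (act x^-1%g a) (act x^-1%g b) k c -> a < act x k /\ act x k < b.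
  move=> /(act_sep x); rewrite !actVK.
  rewrite /sep /cyc => /orP[]/andP[]/or3P[]/andP[? ?] /or3P[]/andP[? ?]; lra.
move=> /inx[ak1 k1b] /inx[ak2 k2b].
have bc : b < act x c by rewrite actVK; lra.
have [_ /(_ bc) nc] := order_continuous_act c x b.
exists ([set x' : T | (a < act x' k1 /\ act x' k1 < b) /\
    (a < act x' k2 /\ act x' k2 < b) /\ b < act x' c],
  [set y' : T | k1 < act y' p /\ act y' p < k2]) => /=.
  split; last exact: (near_box k1q qk2).
  exact: filterI (near_box ak1 k1b) (filterI (near_box ak2 k2b) nc).
move=> [x' y'] /= [[[a1 b1] [[a2 b2] bc']] [y1 y2]]; rewrite actM.
apply: (sep_inside a1 b1 a2 b2 (or_intror (ltW bc'))).
exact/act_sep/sep_out_in.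
Qed.

Lemma order_inv_continuous : continuous (fun z : T => (z : G)^-1%g : T).
Proof.
move=> x; have FF : Filter ((fun z : T => (z : G)^-1%g : T) @ nbhs x).
  exact: fmap_filter.
apply: (order_pointwise_cvg FF) => p a b; set q := act x^-1%g p => aq qb.
pose k1 := (a + q) / 2; pose k2 := (q + b) / 2.
have : sep k1 k2 q b by apply: sep_out_in; rewrite /k1 /k2; [lra|lra|right; lra].
move=> /(act_sep x); rewrite actVK => sx.
have := near_sep (order_continuous_act k1 x) (order_continuous_act k2 x)
  (order_continuous_cst p x) (order_continuous_act b x) sx.
apply: filterS => y /= /(act_sep (y : G)^-1%g); rewrite !actK.
by apply: sep_inside; rewrite ?/k1 ?/k2; try lra; right.
Qed.

Lemma order_hausdorff : hausdorff_space T.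
Proof.
move=> x y cl; apply: act_faithful => p; apply: contrapT => /eqP.
wlog xy : x y cl / act x p < act y p.
  move=> wl; rewrite neq_lt => /orP[h|h]; first by apply: (wl x y) => //; rewrite lt_eqF.
  apply: (wl y x) => //; last by rewrite lt_eqF.
  by move=> A B nA nB; rewrite setIC; exact: cl.
move=> _; pose m := (act x p + act y p) / 2.
have xm : act x p < m by rewrite /m; lra.
have my : m < act y p by rewrite /m; lra.
have [/(_ xm) nx _] := order_continuous_act p x m.
have [_ /(_ my) ny] := order_continuous_act p y m.
by have [z [/= zm mz]] := cl _ _ nx ny; have := lt_trans zm mz; rewrite ltxx.
Qed.

Lemma order_hausdorff_group_topology : hausdorff_group_topology order_topology.
Proof.
split; [split|]; [exact: order_mul_continuous|exact: order_inv_continuous|].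
exact: order_hausdorff.
Qed.

Hypothesis act_increasing : forall f, increasing_bijection f -> exists x, act x =1 f.

(** The map f moves m to m' and f' moves m' to m'' while fixing m, so the two
    products differ at m. *)
Lemma ex_noncommuting_supported c d : c < d -> exists f f' : G,
  [/\ (f * f')%g <> (f' * f)%g, forall t, act f t <> t -> c < t /\ t < d &
      forall t, act f' t <> t -> c < t /\ t < d].
Proof.
move=> cd; pose m := (c + d) / 2; pose m' := (c + m) / 2; pose m'' := (c + m') / 2.
have [cm md] : c < m /\ m < d by rewrite /m; split; lra.
have [cm' mm'] : c < m' /\ m' < m by rewrite /m'; split; lra.
have [cm'' mm''] : c < m'' /\ m'' < m' by rewrite /m''; split; lra.
have md' := lt_trans mm' md; have mm2 := lt_trans mm'' mm'.
have [f fE] := act_increasing (bump_increasing cm md cm' md').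
have [f' f'E] := act_increasing (bump_increasing cm' mm' cm'' mm2).
exists f, f'; split.
- move=> /(congr1 (fun x => act x m)); rewrite !actM f'E fE f'E fE.
  rewrite [bump c m m' m'' m]bump_out; last by right.
  by rewrite !bump_at// => e; move: mm''; rewrite -e ltxx.
- move=> t; rewrite fE => ne; split; rewrite ltNge; apply/negP => h; apply: ne;
    by rewrite bump_out//; tauto.
- move=> t; rewrite f'E => ne; split; first rewrite ltNge.
    by apply/negP => h; apply: ne; rewrite bump_out//; left.
  apply: lt_trans md; rewrite ltNge; apply/negP => h; apply: ne.
  by rewrite bump_out//; right.
Qed.

(** If y is close to x then g = y x^-1 moves some points of the intervals (a, q),
    (q, b) and (b, b + 1) within these intervals; by separation g q is between the
    images of the first two. *)
Lemma order_topology_minimum : minimum_hausdorff_group_topology order_topology.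
Proof.
split=> [|sigma hs U oU]; first exact: order_hausdorff_group_topology.
rewrite /opens openE => x Ux.
have : nbhs (x : T) U by exact: open_nbhs_nbhs.
have FF : Filter (nbhs (x : Topological.Pack sigma)) by exact: nbhs_filter.
apply: (order_pointwise_cvg FF) => p a b; set q := act x p => aq qb.
have near_in_arc c d : c < d -> nbhs (x : Topological.Pack sigma)
    [set y | exists t, (c < t /\ t < d) /\
       (c < act (y * x^-1)%g t /\ act (y * x^-1)%g t < d)].
  move=> cd; have [f [f' [ff' sf sf']]] := ex_noncommuting_supported cd.
  have := near_meets_support hs actM act1 act_faithful x ff'.
  by apply: filterS => y [t [/sf ? /sf' ?]]; exists t.
have b1 : b < b + 1 by lra.
apply: filterS (filterI (near_in_arc a q aq)
  (filterI (near_in_arc q b qb) (near_in_arc b (b + 1) b1))).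
move=> y [[t1 [[at1 t1q] [h1 h1']]] [[t2 [[qt2 t2b] [h2 h2']]] [t3 [[bt3 _] [h3 _]]]]].
have /(act_sep (y * x^-1)%g) : sep t1 t2 q t3.
  by apply: sep_out_in => //; right; exact: lt_trans bt3.
have -> : act (y * x^-1)%g q = act y p by rewrite actM actK.
by apply: sep_inside; rewrite ?(lt_trans h1')// ?(lt_trans aq)//; right; exact: ltW.
Qed.
End OrderGroupTopology.

(** * Permutation groups of the natural numbers *)

Definition swap (a b n : nat) : nat := if n == a then b else if n == b then a else n.

Lemma swapK a b : involutive (swap a b).
Proof.
move=> n; rewrite /swap; case: (eqVneq n a) => [->|na].
  by rewrite eqxx; case: eqVneq.
by case: (eqVneq n b) => [->|nb]; rewrite ?eqxx// (negbTE na) (negbTE nb).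
Qed.

Definition swap_SN a b : SN := SN_of (Bijective (swapK a b) (swapK a b)).

Lemma swap_SNE a b n : swap_SN a b n = swap a b n. Proof. by []. Qed.

Lemma automorphism_group_closed (H : set SN) : automorphism_group H ->
  forall g : SN, (forall F : seq nat, exists2 h : SN, H h & {in F, h =1 g}) -> H g.
Proof.
move=> [L [M ->]] g gF; split=> [r t|f t].
  have [h [Hr _] hg] := gF t; rewrite (Hr r t).
  by have -> : map_tuple h t = map_tuple g t by apply: val_inj; exact/eq_in_map.
have [h [_ Hf] hg] := gF (fun_interp M t :: t).
rewrite -hg ?mem_head// Hf; congr (fun_interp M _); apply: val_inj.
by apply/eq_in_map => n nt; apply: hg; rewrite inE nt orbT.
Qed.

Section SubgroupOfSN.
Local Open Scope nat_scope.
Variables (H : pred SN) (G : subGroupType H).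

Definition act_nat (x : G) : nat -> nat := (\val x : SN).

Lemma act_natM x y n : act_nat (x * y)%g n = act_nat x (act_nat y n).
Proof. by rewrite /act_nat gmulfM. Qed.

Lemma act_nat1 n : act_nat 1%g n = n.
Proof. by rewrite /act_nat gmulf1. Qed.

Lemma act_nat_faithful x y : act_nat x =1 act_nat y -> x = y.
Proof. by move=> xy; apply: val_inj; exact: SN_ext. Qed.

Lemma ex_act_nat (g : SN) : H g -> exists x : G, act_nat x =1 g.
Proof. by move=> Hg; exists (Sub g Hg) => n; rewrite /act_nat SubK. Qed.

(** Let g = y x^-1 with y close to x. If g a <> a, choose c among a + 4 and a + 5 with
    g a <> c. As (a b) and (a c) do not commute, g maps a or b into {a, c}; so it maps
    b = a + 1, a + 2 and a + 3 into the two points a and c, a contradiction. *)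
Lemma pointwise_coarser_full (sigma : Topological G) : [set g | H g] = [set: SN] ->
  hausdorff_group_topology sigma -> coarser (pointwise_topology G) sigma.
Proof.
move=> HT hs U oU; rewrite /opens openE => x Ux.
have [F FU] : exists F : seq nat, [set y : G | {in F, act_nat y =1 act_nat x}] `<=` U.
  by apply/(nbhs_pointwise (G := G) x U); exact: open_nbhs_nbhs.
have all_sub (g : SN) : exists y : G, act_nat y =1 g.
  by apply: ex_act_nat; have : [set g | H g] g by rewrite HT.
suff fix_near n : nbhs (x : Topological.Pack sigma) [set y : G | act_nat y n = act_nat x n].
  apply: (filterS FU); apply: near_in => n _; exact: fix_near.
pose a := act_nat x n.
have meets b c : b != a -> c != a -> b != c ->
    nbhs (x : Topological.Pack sigma) [set y : G | exists t, (t = a \/ t = b) /\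
      (act_nat (y * x^-1)%g t = a \/ act_nat (y * x^-1)%g t = c)].
  move=> ba ca bc; have [f fE] := all_sub (swap_SN a b).
  have [f' f'E] := all_sub (swap_SN a c).
  have ff' : (f * f')%g <> (f' * f)%g.
    move=> /(congr1 (fun z => act_nat z a)).
    rewrite !act_natM f'E !fE f'E !swap_SNE /swap !eqxx.
    rewrite (negbTE ca) (negbTE ba) (eq_sym c b) (negbTE bc).
    by move=> cb; rewrite cb eqxx in bc.
  have := near_meets_support hs act_natM act_nat1 act_nat_faithful x ff'.
  have moved z w m : swap z w m <> m -> m = z \/ m = w.
    by rewrite /swap; case: eqVneq => [->|_]; [left|case: eqVneq => [->|//]; right].
  apply: filterS => y [t [ft f't]]; exists t; rewrite fE in ft; rewrite f'E in f't.
  by split; exact: moved.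
have ne k : a + k.+1 != a by rewrite -[X in _ != X]addn0 eqn_add2l.
have nm k l : k != l -> a + k.+1 != a + l.+1 by rewrite eqn_add2l.
have M14 := meets (a + 1) (a + 4) (ne 0) (ne 3) (nm 0 3 isT).
have M24 := meets (a + 2) (a + 4) (ne 1) (ne 3) (nm 1 3 isT).
have M34 := meets (a + 3) (a + 4) (ne 2) (ne 3) (nm 2 3 isT).
have M15 := meets (a + 1) (a + 5) (ne 0) (ne 4) (nm 0 4 isT).
have M25 := meets (a + 2) (a + 5) (ne 1) (ne 4) (nm 1 4 isT).
have M35 := meets (a + 3) (a + 5) (ne 2) (ne 4) (nm 2 4 isT).
apply: filterS (filterI (filterI M14 (filterI M24 M34)) (filterI M15 (filterI M25 M35))).
move=> y [[m14 [m24 m34]] [m15 [m25 m35]]] /=.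
have -> : act_nat y n = act_nat (y * x^-1)%g a.
  by rewrite act_natM /a -(act_natM x^-1%g) mulVg act_nat1.
have ginj := act_inj act_natM act_nat1 (x := (y * x^-1)%g).
move: m14 m24 m34 m15 m25 m35; rewrite /mkset.
move: (act_nat _) ginj => g ginj m14 m24 m34 m15 m25 m35.
rewrite -/a; apply: contrapT => ga.
have third c : g a <> c -> (exists t, (t = a \/ t = a + 1) /\ (g t = a \/ g t = c)) ->
    (exists t, (t = a \/ t = a + 2) /\ (g t = a \/ g t = c)) ->
    (exists t, (t = a \/ t = a + 3) /\ (g t = a \/ g t = c)) -> False.
  move=> gc [t1 [t1E g1]] [t2 [t2E g2]] [t3 [t3E g3]].
  have e1 : t1 = a + 1 by case: t1E => // e; subst t1; case: g1.
  have e2 : t2 = a + 2 by case: t2E => // e; subst t2; case: g2.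
  have e3 : t3 = a + 3 by case: t3E => // e; subst t3; case: g3.
  have i12 : g t1 <> g t2 by move=> /ginj; lia.
  have i13 : g t1 <> g t3 by move=> /ginj; lia.
  have i23 : g t2 <> g t3 by move=> /ginj; lia.
  by case: g1 => ?; case: g2 => ?; case: g3 => ?; congruence.
have [g4|g4] := eqVneq (g a) (a + 4).
  by apply: (third (a + 5)) => //; rewrite g4; lia.
by apply: (third (a + 4)) => //; exact/eqP.
Qed.

Lemma pointwise_topology_minimum : [set g | H g] = [set: SN] ->
  minimum_hausdorff_group_topology (pointwise_topology G).
Proof.
move=> HT; split; first exact: pointwise_hausdorff_group_topology.
by move=> sigma; exact: pointwise_coarser_full.
Qed.

Local Open Scope ring_scope.

Hypothesis closedH :
  forall g : SN, (forall F : seq nat, exists2 h : SN, H h & {in F, h =1 g}) -> H g.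
Variables (phi : rat -> nat) (psi : nat -> rat).
Hypotheses (phiK : cancel phi psi) (psiK : cancel psi phi).
Hypothesis H_increasing :
  forall f (g : SN), increasing_bijection f -> g =1 phi \o f \o psi -> H g.

Definition act_rat (x : G) : rat -> rat := psi \o act_nat x \o phi.

Lemma act_ratM x y t : act_rat (x * y)%g t = act_rat x (act_rat y t).
Proof. by rewrite /act_rat /= act_natM psiK. Qed.

Lemma act_rat1 t : act_rat 1%g t = t.
Proof. by rewrite /act_rat /= act_nat1 phiK. Qed.

Lemma act_natE x n : act_nat x n = phi (act_rat x (psi n)).
Proof. by rewrite /act_rat /= !psiK. Qed.

Lemma act_rat_faithful x y : act_rat x =1 act_rat y -> x = y.
Proof. by move=> xy; apply: act_nat_faithful => n; rewrite !act_natE xy. Qed.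

Lemma act_rat_increasing f : increasing_bijection f -> exists x, act_rat x =1 f.
Proof.
move=> incf; have [[f' fK f'K] _] := incf.
have bg : bijective (phi \o f \o psi).
  by exists (phi \o f' \o psi) => n /=; rewrite phiK ?fK ?f'K psiK.
have [x xE] := ex_act_nat (H_increasing (g := SN_of bg) incf (frefl _)).
by exists x => t; rewrite /act_rat /= xE /= phiK phiK.
Qed.

Definition rational_copy : set (rat -> rat) := [set k | exists x, act_rat x =1 k].

Lemma rational_copy_comp k k' :
  rational_copy k -> rational_copy k' -> rational_copy (k \o k').
Proof.
by move=> [x xk] [y yk']; exists (x * y)%g => t; rewrite act_ratM yk' xk.
Qed.

Lemma rational_copy_inj k : rational_copy k -> injective k.
Proof.
by move=> [x xk] s t; rewrite -!xk => /(act_inj act_ratM act_rat1).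
Qed.

(** All injective sequences of a given length are in one orbit, so each permutation
    agrees on each finite set with an element of the group, which is closed. *)
Lemma full_of_all_good : all_good rational_copy -> [set g | H g] = [set: SN].
Proof.
move=> all_good; apply/seteqP; split=> // g _; apply: closedH => F.
pose s := map psi (undup F); pose t := map psi (map g (undup F)).
have psi_inj : injective psi by exact: can_inj psiK.
have us : uniq s by rewrite map_inj_uniq// undup_uniq.
have ut : uniq t by rewrite !map_inj_uniq ?undup_uniq//; exact: bij_inj (SN_bij g).
have [k1 [x1 x1E] sk1] := all_good _ us; have [k2 [x2 x2E] sk2] := all_good _ ut.
have [|f /act_rat_increasing[x3 x3E] fk] := ex_increasing_bijection _ sk1 sk2.
  by rewrite !size_map.
exists (\val (x2^-1 * (x3 * x1))%g); first exact: valP.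
move=> n nF; rewrite -/(act_nat _) act_natE !act_ratM x1E x3E.
have -> : f (k1 (psi n)) = k2 (psi (g n)).
  move: fk; rewrite /s /t -!map_comp => /eq_in_map; apply.
  by rewrite mem_undup.
by rewrite -x2E -act_ratM mulVg act_rat1 psiK.
Qed.

(** The stabilizer of 0 is open for the pointwise topology, but a bump supported near 0
    that moves 0 is in any given basic neighborhood of the identity. *)
Lemma order_topology_strictly_coarser :
  coarser (order_topology act_rat) (pointwise_topology G) ->
  strictly_coarser (order_topology act_rat) (pointwise_topology G).
Proof.
move=> cp; split=> // pc; pose U : set G := [set x | act_rat x 0 = 0].
have oU : opens (pointwise_topology G) U.
  rewrite /opens openE => x Ux; apply/(nbhs_pointwise (G := G) x U).
  exists [:: phi 0] => y /(_ (phi 0)); rewrite mem_head => /(_ isT) yx.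
  by rewrite /U /= /act_rat /= /act_nat yx.
have /pc : opens (pointwise_topology G) U by [].
move=> /(_ 1%g)[|L [L1 LU]]; first exact: act_rat1.
have [k1 [k2 [k10 k20 iso]]] :=
  ex_isolating (flatten [seq [:: p.1; p.2.1; p.2.2] | p <- L]) 0.
have [x xE] : exists x, act_rat x =1 bump k1 k2 0 (k2 / 2).
  by apply/act_rat_increasing/bump_increasing; lra.
have : U x.
  apply: LU => p a b pL; have := L1 p a b pL; rewrite act_rat1 xE => -[ap pb].
  have inL z : z \in [:: p; a; b] -> z \in flatten [seq [:: p.1; p.2.1; p.2.2] | p <- L].
    by move=> zp; apply/flatten_mapP; exists (p, (a, b)).
  have /inL/iso ip : p \in [:: p; a; b] by rewrite inE eqxx.
  have /inL/iso ia : a \in [:: p; a; b] by rewrite !inE eqxx orbT.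
  have /inL/iso ib : b \in [:: p; a; b] by rewrite !inE eqxx !orbT.
  case: ip => [p0|pk|pk]; [|by rewrite bump_out//; left; exact: ltW|
    by rewrite bump_out//; right; exact: ltW].
  rewrite p0 bump_at//; rewrite p0 in ap pb.
  by split; [case: ia|case: ib] => ?; lra.
rewrite /U /= xE bump_at//; lra.
Qed.

End SubgroupOfSN.

Theorem theorem19 (H : pred SN) (G : subGroupType H)
  (autH : automorphism_group [set g | H g])
  (oligoH : oligomorphic [set g | H g])
  (homH : highly_homogeneous [set g | H g]) :
  (exists m : Topological G,
     minimum_hausdorff_group_topology m /\
     (strictly_coarser m (pointwise_topology G) <-> [set g | H g] <> [set: SN])) /\
  ([set g | H g] <> [set: SN] ->
     ~ minimal_hausdorff_group_topology (pointwise_topology G)).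
Proof.
have [HT|HnT] := pselect ([set g | H g] = [set: SN]).
  split=> //; exists (pointwise_topology G); split; first exact: pointwise_topology_minimum.
  by split=> // -[_]; case.
suff [m [mmin mlt]] : exists m : Topological G, minimum_hausdorff_group_topology m /\
    strictly_coarser m (pointwise_topology G).
  split=> [|_ [_ /(_ m)]]; first by exists m; split.
  by have [[mg mh] _] := mmin; move=> /(_ mg mlt).
have closedH := automorphism_group_closed autH.
have H1 : [set g | H g] 1%g by have := valP (1%g : G); rewrite gmulf1.
have HM g h : H g -> H h -> H (g * h)%g.
  move=> Hg Hh; have := valP (Sub g Hg * Sub h Hh : G)%g.
  by rewrite gmulfM /= !SubK.
have HV g : H g -> H (g^-1)%g.
  move=> Hg; have := valP ((Sub g Hg : G)^-1)%g.
  by rewrite gmulfV /= SubK.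
have [U UU Uinf] := ex_ultra_nat.
have [phi [psi [phiK psiK Hinc]]] := ex_rational_order H1 HM HV oligoH homH UU Uinf closedH.
have [F [FU Fleft]] := ex_left_ultrafilters.
pose act := act_rat (G := G) phi psi; pose K := rational_copy G phi psi.
have Kcomp := @rational_copy_comp H G phi psi psiK.
have Kinj := @rational_copy_inj H G phi psi phiK psiK.
have actinc := @act_rat_increasing H G phi psi phiK psiK Hinc.
have ngood : ~ all_good K by move=> /(full_of_all_good closedH phiK psiK Hinc).
have Ksep (x : G) a b c d : sep a b c d -> sep (act x a) (act x b) (act x c) (act x d).
  by apply: (sep_homo Kcomp Kinj actinc FU Fleft ngood); exists x.
have mmin : minimum_hausdorff_group_topology (order_topology act).
  apply: order_topology_minimum => //.
  - exact: act_ratM.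
  - exact: act_rat1.
  - exact: act_rat_faithful.
exists (order_topology act); split=> //.
apply: order_topology_strictly_coarser => //.
by have [_ /(_ _ (pointwise_hausdorff_group_topology G))] := mmin.
Qed.
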